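(* The processor that maps a DP problem $(\mathcal P,\mathcal R,m,f)$ with $m=\mathtt{minimal}$ or $m=\mathtt{computable}_S$ for some rule set $S$ to $\{(\mathcal P_2,\mathcal R,m,f)\}$, provided that $\mathcal P=\mathcal P_1\uplus\mathcal P_2$ is non-collapsing and there is a projection function $\nu$ for $\mathcal P$ with $\overline\nu(\ell)\rhd\overline\nu(p)$ for every $\ell\Rrightarrow p\ (A)\in\mathcal P_1$ and $\overline\nu(\ell)=\overline\nu(p)$ for every $\ell\Rrightarrow p\ (A)\in\mathcal P_2$ (and mapping any other DP problem $M$ to $\{M\}$), is both sound and complete.
   Context: Base formalism. Sorts $\mathcal S$; simple types are sorts and $\sigma\to\tau$. Disjoint typed sets $\mathcal F$, $\mathcal V$ (infinitely many of each type), meta-variables $\mathcal M$ with declarations $[\sigma_1\times..\times\sigma_k]\to\tau$, $k=\mathrm{ar}(Z)$. Meta-terms: variables, symbols, typed application (left-assoc.), $\lambda x.s$, $Z\langle s_1..s_e\rangle$ ($e\ge\mathrm{ar}(Z)$); modulo $\alpha$; terms contain no meta-variables; $FV,FMV$; $s\unrhd t$ subterm ($s=t$, or inside an abstraction body or either side of an application), $\rhd$ strict subterm. Patterns: $Z\langle x_1..x_k\rangle$ (distinct, $k=\mathrm{ar}(Z)$), $\lambda x.\ell$, $a\,\ell_1..\ell_n$ ($a\in\mathcal F\cup\mathcal V$); fully extended (each bound $y$ of $\lambda y.\ell'$ passed to all meta-variables in $\ell'$), linear (meta-variables once). Substitutions: variables to terms, $Z$ (arity $k$) to $\lambda y_1..y_k.u$;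 $\gamma(Z)\approx_e\lambda x_1..x_e.s$ iff $\gamma(Z)=\lambda x_1..x_e.s$ or $\gamma(Z)=\lambda x_1..x_i.t$, $k\le i<e$, $t$ not an abstraction, $s=t\,x_{i+1}..x_e$; $Z\langle s_1..s_e\rangle\gamma=t[x_1:=s_1\gamma,..]$ for $\gamma(Z)\approx_e\lambda\vec x.t$; structural, capture-avoiding otherwise. Rules $\ell\Rightarrow r$: closed, same type, $\ell$ a pattern headed by $f\in\mathcal F$, $FMV(r)\subseteq FMV(\ell)$; $\to_S$ the smallest context-closed (also under $\lambda$) relation with $\ell\delta\to r\delta$ and $(\lambda x.s)t\to s[x:=t]$. $\mathcal D$ defined symbols; arity function $\mathrm{ar}$. Fixed sort quasi-ordering $\succeq$ with well-founded strict part; $\mathrm{Acc}(f)=\{i\mid\iota\succeq_+\sigma_i\}$ for $f:\sigma_1\to..\to\sigma_m\to\iota$, with $\iota\succeq_+\tau_1\to..\to\tau_n\to\kappa$ iff $\iota\succeq\kappa$ and all $\iota\succ_-\tau_j$, $\iota\succ_-\tau$ iff $\iota\succ\kappa$ and all $\iota\succeq_+\tau_j$. DPs. $\mathcal F^\sharp=\mathcal F\uplus\{f^\sharp\mid f\in\mathcal D\}$; $s^\sharp=f^\sharp\vec s$ if $s=f\,s_1..s_k$, $f\in\mathcal D$, $k=\mathrm{ar}(f)$, else $s$. $\gamma$ respects conditions $A$ ($Z:i$) if, writing $\gamma(Z)=\lambda x_1..x_n.t$ ($t$ not an abstraction), $i>n$ or $x_i\in FV(t)$. DP $\ell\Rrightarrow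 p\ (A)$: $\ell$ closed pattern $f\,\ell_1..\ell_n$, $f\in\mathcal F^\sharp$, $n\ge\mathrm{ar}(f)$; collapsing if $p=Z\langle s_1..s_e\rangle t_1..t_j$ ($e,j\ge0$); a set of DPs is non-collapsing if it contains no collapsing DP. $s\unrhd_At$: $s=t\,\vec s$; or $s=\lambda x.u$, $u\unrhd_At$; or $s=(\lambda x.u)s_0..s_n$, $u[x:=s_0]s_1..s_n\unrhd_At$; or $s=a\,s_1..s_n$ ($a$ abstraction, meta-variable application, or in $\mathcal V\cup\mathcal F$), $s_i\unrhd_At$; or $s=Z\langle t_1..t_e\rangle\vec s$, $t_i\unrhd_At$, $(Z:i)\in A$. Chains: a $(\mathcal P,\mathcal R)$-chain is an infinite $[(\rho_i,s_i,t_i)]$, $\rho_i\in\mathcal P\cup\{\mathtt{beta}\}$: (1) $\rho_i=\mathtt{beta}$: $s_i=(\lambda x.u)v\,w_1..w_n$, and $n>0$, $t_i=u[x:=v]\vec w$, or $n=0$, $t_i=q^\sharp[x:=v]$, $u\unrhd q$, $x\in FV(q)$, $q\ne x$; (2) $\rho_i=\ell_i\Rrightarrow p_i\ (A_i)$: some $\gamma$ on $FMV(\ell_i)\cup FMV(p_i)\cup FV(p_i)$ mapping $FV(p_i)$ to fresh variables and respecting $A_i$, $s_i=\ell_i\gamma$, $t_i=p_i\gamma$ if $p_i$ is an application or symbol $f^\sharp$, and if $p_i=Z\langle u_1..u_e\rangle$, $\gamma(Z)\approx_e\lambda x_1..x_e.w$, $t_i=v^\sharp[x_1:=u_1\gamma,..]$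 for a non-variable subterm $v$ of $w$ with some $x_j$ free; (3) $t_i=s_{i+1}$ or $t_i=f\,\vec u$, $s_{i+1}=f\,\vec w$, $f\in\mathcal F^\sharp$, $u_j\to^*_{\mathcal R}w_j$. Minimal: strict subterms of all $t_i$ terminate under $\to_{\mathcal R}$. Formative: whenever $\rho_{i+1}=\ell\Rrightarrow p\ (A)\in\mathcal P$, $t_i\to^*_{\mathcal R}s_{i+1}$ is $\ell$-formative, where $s\to^*\ell\gamma$ is $\ell$-formative if inductively: $\ell$ not fully extended linear; or $\ell=Z\langle\vec x\rangle$, $s=\ell\gamma$; or $s=a\,\vec s$, $\ell=a\,\vec\ell$ ($a\in\mathcal F^\sharp\cup\mathcal V$) with each $s_i\to^*\ell_i\gamma$ $\ell_i$-formative; or $s=\lambda x.s'$, $\ell=\lambda x.\ell'$, $s'\to^*\ell'\gamma$ $\ell'$-formative; or $s=(\lambda x.u)v\,\vec w$ and $u[x:=v]\vec w\to^*\ell\gamma$ $\ell$-formative; or $\ell$ not a meta-variable application and $s\to^*(\ell'\vec Z)\delta$ $\ell'$-formative, $(r'\vec Z)\delta\to^*\ell\gamma$ $\ell$-formative for some $\ell'\Rightarrow r'\in\mathcal R$. $S$-computable: with $C_S$ an RC-set for $\to_S$ (base-type terms, terminating, closed under $\to_S$, containing any $x\,\vec s$ or $(\lambda x.u)s_0..s_n$ with all reducts in it; computability: $s:\iota$ iff $s\in C_S$, $s:\sigma\to\tau$ iff $s\,t$ computable for computable $t$) satisfying $C_S=\{s:\iota\mid s$ terminating under $\to_S\cup\to_{\mathrm{acc}}$,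 and $s\to^*_Sf\,\vec s:\iota$ implies $s_i$ computable for $i\in\mathrm{Acc}(f)\}$ ($f\,\vec s\to_{\mathrm{acc}}s_i\,t_1..t_n$ for base-type sides, $i\in\mathrm{Acc}(f)$, computable $t_j$): chain is $S$-computable if $\to_S\supseteq\to_{\mathcal R}$ and each $i$ has $\gamma_i$ with $\rho_i=\ell_i\Rrightarrow p_i\ (A_i)$, $s_i=\ell_i\gamma_i$, $t_i=p_i\gamma_i$, and $(\lambda x_1..x_n.v)\gamma_i$ computable whenever $p_i\unrhd_Bv$, $\gamma_i$ respects $B$, $FV(v)=\{x_1..x_n\}$. DP problems $(\mathcal P,\mathcal R,m,f)$, $m\in\{\mathtt{minimal},\mathtt{arbitrary}\}\cup\{\mathtt{computable}_S\}$, $f\in\{\mathtt{formative},\mathtt{all}\}$: finite if no chain is $S$-computable when $m=\mathtt{computable}_S$, minimal when $m=\mathtt{minimal}$, formative when $f=\mathtt{formative}$; infinite if not finite or $\to_{\mathcal R}$ non-terminating. Processors map DP problems to NO or sets of DP problems; sound: $M$ finite whenever $\mathrm{Proc}(M)\ne$ NO and all elements finite; complete: $M$ infinite whenever $\mathrm{Proc}(M)=$ NO or contains an infinite element. Projection functions: for non-collapsing $\mathcal P$, $\mathrm{heads}(\mathcal P)$ is the set of symbols heading a left- or right-hand side of a DP in $\mathcal P$; a projection function for $\mathcal P$ is $\nu:\mathrm{heads}(\mathcal P)\to\mathbb N$ such that for all $\ell\Rrightarrow p\ (A)\in\mathcal P$, $\overline\nu(f\,s_1\cdots s_n)=s_{\nu(f)}$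 is well-defined for both $\ell$ and $p$ (i.e. $1\le\nu(f)\le n$). *)

(* Defs.v *)
(* Algebraic functional systems with meta-variables (AFSMs) and the static
   dependency pair framework over them, up to the subterm criterion.

   Sets of rules, dependency pairs and problems are Prop-valued predicates.
   All meta-terms range over the signature F^sharp; a set of rules is over F
   because its members are required to be free of marked symbols. *)

From Stdlib Require Import List Relations.
From mathcomp Require Import all_boot.

Set Implicit Arguments.
Unset Strict Implicit.
Unset Printing Implicit Defensive.

Inductive ty (sort : Type) : Type :=
| Base of sort
| Arr of ty sort & ty sort.

Definition arrs (sort : Type) (args : seq (ty sort)) (out : ty sort) :=
  foldr (@Arr sort) out args.

Record signature : Type := Signature {
  sort : Type;
  fsym : Type;
  var : eqType;
  mvar : eqType;
  fty : fsym -> ty sort;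
  vty : var -> ty sort;
  (* Z : [sigma_1 x .. x sigma_k] -> tau is declared as the pair
     ([:: sigma_1; ..; sigma_k], tau) *)
  mdecl : mvar -> seq (ty sort) * ty sort;
  var_infinite : forall (sigma : ty sort) (xs : seq var),
    exists2 x, vty x = sigma & x \notin xs;
  defined : pred fsym;
  arity : fsym -> nat;
  sort_ge : sort -> sort -> Prop;
  sort_ge_refl : forall a, sort_ge a a;
  sort_ge_trans : forall a b c, sort_ge a b -> sort_ge b c -> sort_ge a c;
  sort_gt_wf : well_founded (fun a b => sort_ge b a /\ ~ sort_ge a b)
}.

Section AFSM.

Context (A : signature).

Notation type := (ty (sort A)).

(* F^sharp: inl f is f, inr f is the marked copy of the defined symbol f *)
Definition symbol : Type := (fsym A + {f : fsym A | defined f})%type.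

Definition base_symbol (f : symbol) : fsym A :=
  match f with inl g => g | inr g => val g end.

Definition symbol_ty (f : symbol) : type := fty (base_symbol f).

Definition symbol_arity (f : symbol) : nat := arity (base_symbol f).

Definition marity (Z : mvar A) : nat := size (mdecl Z).1.

(* Locally nameless syntax: bound variables are de Bruijn indices and free
   variables are names, so that equality is alpha-equivalence. Indices are only
   manipulated by the first few functions below; everything else is phrased
   with the named abstraction [lam x s], i.e. lambda x. s *)
Inductive mterm : Type :=
| BVar of nat
| FVar of var A
| Fun of symbol
| App of mterm & mterm
| Lam of type & mterm
| MApp of mvar A & seq mterm.

Fixpoint fv (s : mterm) : seq (var A) :=
  match s with
  | BVar _ | Fun _ => [::]
  | FVar x => [:: x]
  | App s t => fv s ++ fv t
  | Lam _ s => fv s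
  | MApp _ ss => flatten (map fv ss)
  end.

(* with one entry per occurrence *)
Fixpoint fmv (s : mterm) : seq (mvar A) :=
  match s with
  | BVar _ | FVar _ | Fun _ => [::]
  | App s t => fmv s ++ fmv t
  | Lam _ s => fmv s
  | MApp Z ss => Z :: flatten (map fmv ss)
  end.

Definition closed (s : mterm) : Prop := fv s = [::].

Fixpoint unmarked (s : mterm) : bool :=
  match s with
  | BVar _ | FVar _ => true
  | Fun f => if f is inl _ then true else false
  | App s t => unmarked s && unmarked t
  | Lam _ s => unmarked s
  | MApp _ ss => all unmarked ss
  end.

Definition is_var (s : mterm) : bool := if s is FVar _ then true else false.
Definition is_app (s : mterm) : bool := if s is App _ _ then true else false.
Definition is_lam (s : mterm) : bool := if s is Lam _ _ then true else false.
Definition is_mapp (s : mterm) : bool := if s is MApp _ _ then true else false.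
Definition is_atom (s : mterm) : bool :=
  match s with FVar _ | Fun _ => true | _ => false end.

Definition apps (s : mterm) (ts : seq mterm) : mterm := foldl App s ts.

Fixpoint spine_head (s : mterm) : mterm :=
  if s is App t _ then spine_head t else s.

Fixpoint spine_args (s : mterm) : seq mterm :=
  if s is App t u then rcons (spine_args t) u else [::].

Fixpoint close (k : nat) (x : var A) (s : mterm) : mterm :=
  match s with
  | BVar n => BVar (if n < k then n else n.+1)
  | FVar y => if y == x then BVar k else FVar y
  | Fun f => Fun f
  | App s t => App (close k x s) (close k x t)
  | Lam sigma s => Lam sigma (close k.+1 x s)
  | MApp Z ss => MApp Z (map (close k x) ss)
  end.

Definition lam (x : var A) (s : mterm) : mterm := Lam (vty x) (close 0 x s).

Definition lams (xs : seq (var A)) (s : mterm) : mterm := foldr lam s xs.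

Fixpoint lift (c d : nat) (s : mterm) : mterm :=
  match s with
  | BVar n => BVar (if n < c then n else n + d)
  | FVar x => FVar x
  | Fun f => Fun f
  | App s t => App (lift c d s) (lift c d t)
  | Lam sigma s => Lam sigma (lift c.+1 d s)
  | MApp Z ss => MApp Z (map (lift c d) ss)
  end.

(* replaces the indices k, k+1, .. by the entries of us, simultaneously *)
Fixpoint inst (k : nat) (us : seq mterm) (s : mterm) : mterm :=
  match s with
  | BVar n =>
      if n < k then BVar n
      else if n < k + size us then lift 0 k (nth (BVar n) us (n - k))
      else BVar (n - size us)
  | FVar x => FVar x
  | Fun f => Fun f
  | App s t => App (inst k us s) (inst k us t)
  | Lam sigma s => Lam sigma (inst k.+1 us s)
  | MApp Z ss => MApp Z (map (inst k us) ss)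
  end.

(* [strip e t] is the de Bruijn body of the s with t ~_e lambda x_1 .. x_e. s:
   eta-expansion when t starts with fewer than e abstractions *)
Fixpoint strip (e : nat) (t : mterm) : mterm :=
  match e, t with
  | 0, _ => t
  | e'.+1, Lam _ u => strip e' u
  | e'.+1, _ => apps (lift 0 e t) (map BVar (rev (iota 0 e)))
  end.

(* s[x_1 := u_1, .., x_e := u_e] where t ~_e lambda x_1 .. x_e. s *)
Definition approx_inst (t : mterm) (us : seq mterm) : mterm :=
  inst 0 (rev us) (strip (size us) t).

(* Substitutions are the identity outside their domain; for meta-variables
   the domain is explicit *)
Record msubst : Type := MSubst {
  on_var : var A -> mterm;
  on_mvar : mvar A -> option mterm
}.

Fixpoint subst (gamma : msubst) (s : mterm) : mterm :=
  match s with
  | BVar n => BVar n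
  | FVar x => on_var gamma x
  | Fun f => Fun f
  | App s t => App (subst gamma s) (subst gamma t)
  | Lam sigma s => Lam sigma (subst gamma s)
  | MApp Z ss =>
      if on_mvar gamma Z is Some t then approx_inst t (map (subst gamma) ss)
      else MApp Z (map (subst gamma) ss)
  end.

(* s[x_1 := u_1, .., x_n := u_n], for xs and us of the same size *)
Definition vsubst (xs : seq (var A)) (us : seq mterm) (s : mterm) : mterm :=
  subst (MSubst (fun y => nth (FVar y) us (index y xs)) (fun=> None)) s.

Inductive typed : mterm -> type -> Prop :=
| typed_var x : typed (FVar x) (vty x)
| typed_fun f : typed (Fun f) (symbol_ty f)
| typed_app s t sigma tau :
    typed s (Arr sigma tau) -> typed t sigma -> typed (App s t) tau
| typed_lam x s tau : typed s tau -> typed (lam x s) (Arr (vty x) tau)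
| typed_mapp Z ss sigmas tau :
    marity Z <= size ss ->
    arrs (mdecl Z).1 (mdecl Z).2 = arrs sigmas tau ->
    Forall2 typed ss sigmas ->
    typed (MApp Z ss) tau.

Definition term_of (s : mterm) (sigma : type) : Prop :=
  typed s sigma /\ fmv s = [::].

Definition is_term (s : mterm) : Prop := exists sigma, term_of s sigma.

Definition wf_msubst (gamma : msubst) : Prop :=
  (forall x, term_of (on_var gamma x) (vty x)) /\
  (forall Z t, on_mvar gamma Z = Some t ->
     term_of t (arrs (mdecl Z).1 (mdecl Z).2) /\
     exists xs u, size xs = marity Z /\ t = lams xs u).

Definition covers (gamma : msubst) (s : mterm) : Prop :=
  forall Z, Z \in fmv s -> on_mvar gamma Z <> None.

(* Under an abstraction the bound variable may be given any name outside N, as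
   long as the result is the same abstraction. Avoiding names matters only
   when something is then substituted into the subterm. *)
Inductive subterm_avoiding (N : seq (var A)) : mterm -> mterm -> Prop :=
| subterm_refl s : subterm_avoiding N s s
| subterm_lam x s t :
    x \notin N -> subterm_avoiding N s t -> subterm_avoiding N (lam x s) t
| subterm_appl s1 s2 t :
    subterm_avoiding N s1 t -> subterm_avoiding N (App s1 s2) t
| subterm_appr s1 s2 t :
    subterm_avoiding N s2 t -> subterm_avoiding N (App s1 s2) t.

Definition subterm : mterm -> mterm -> Prop := subterm_avoiding [::].

Definition strict_subterm (s t : mterm) : Prop := subterm s t /\ s <> t.

Inductive pattern : mterm -> Prop :=
| pattern_mapp Z xs :
    uniq xs -> size xs = marity Z -> pattern (MApp Z (map FVar xs))
| pattern_lam x l : pattern l -> pattern (lam x l)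
| pattern_app a ls : is_atom a -> Forall pattern ls -> pattern (apps a ls).

Fixpoint passes (k : nat) (s : mterm) : bool :=
  match s with
  | BVar _ | FVar _ | Fun _ => true
  | App s t => passes k s && passes k t
  | Lam _ s => passes k.+1 s
  | MApp _ ss =>
      has (fun t => if t is BVar n then n == k else false) ss &&
      all (passes k) ss
  end.

Fixpoint fully_extended (s : mterm) : bool :=
  match s with
  | BVar _ | FVar _ | Fun _ => true
  | App s t => fully_extended s && fully_extended t
  | Lam _ s => passes 0 s && fully_extended s
  | MApp _ ss => all fully_extended ss
  end.

Definition linear (s : mterm) : bool := uniq (fmv s).

Record rule : Type := Rule {
  rlhs : mterm;
  rrhs : mterm;
  rule_typed : exists sigma, typed rlhs sigma /\ typed rrhs sigma;
  rule_closed : closed rlhs /\ closed rrhs;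
  rule_unmarked : unmarked rlhs /\ unmarked rrhs;
  rule_pattern : pattern rlhs;
  rule_head : exists f ls, rlhs = apps (Fun (inl f)) ls;
  rule_fmv : {subset fmv rrhs <= fmv rlhs}
}.

Inductive step (R : rule -> Prop) : mterm -> mterm -> Prop :=
| step_rule rho delta :
    R rho -> wf_msubst delta -> covers delta (rlhs rho) ->
    step R (subst delta (rlhs rho)) (subst delta (rrhs rho))
| step_beta x s t : step R (App (lam x s) t) (vsubst [:: x] [:: t] s)
| step_appl s s' t : step R s s' -> step R (App s t) (App s' t)
| step_appr s t t' : step R t t' -> step R (App s t) (App s t')
| step_lam x s s' : step R s s' -> step R (lam x s) (lam x s').

Definition steps (R : rule -> Prop) : mterm -> mterm -> Prop :=
  clos_refl_trans mterm (step R).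

Definition sn (r : mterm -> mterm -> Prop) (s : mterm) : Prop :=
  Acc (fun t u => r u t) s.

Definition terminating (R : rule -> Prop) (s : mterm) : Prop := sn (step R) s.

(* [sort_cmp true] is succeq_+, [sort_cmp false] is succ_- *)
Fixpoint sort_cmp (b : bool) (i : sort A) (sigma : type) : Prop :=
  match sigma with
  | Base k => if b then sort_ge i k else sort_ge i k /\ ~ sort_ge k i
  | Arr sigma tau => sort_cmp (~~ b) i sigma /\ sort_cmp b i tau
  end.

(* argument positions are counted from 0 *)
Definition acc_pos (f : symbol) (i : nat) : Prop :=
  exists sigmas k sigma,
    [/\ symbol_ty f = arrs sigmas (Base k), onth sigmas i = Some sigma
      & sort_cmp true k sigma].

Definition base_term (s : mterm) : Prop := exists k, term_of s (Base k).

Fixpoint computable_at (C : mterm -> Prop) (sigma : type) (s : mterm) : Prop :=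
  match sigma with
  | Base k => term_of s (Base k) /\ C s
  | Arr sigma tau =>
      term_of s (Arr sigma tau) /\
      (forall t, computable_at C sigma t -> computable_at C tau (App s t))
  end.

Definition computable (C : mterm -> Prop) (s : mterm) : Prop :=
  exists sigma, computable_at C sigma s.

Definition neutral (s : mterm) : Prop :=
  (exists x ss, s = apps (FVar x) ss) \/
  (exists x u s0 ss, s = apps (lam x u) (s0 :: ss)).

Definition rc_set (U : rule -> Prop) (C : mterm -> Prop) : Prop :=
  [/\ forall s, C s -> base_term s,
      forall s, C s -> terminating U s,
      forall s t, C s -> step U s t -> C t
    & forall s, base_term s -> neutral s -> (forall t, step U s t -> C t) ->
        C s].

Definition acc_step (C : mterm -> Prop) (s t : mterm) : Prop :=
  exists f ss i si ts,
    [/\ s = apps (Fun f) ss, onth ss i = Some si & t = apps si ts] /\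
    [/\ base_term s, base_term t, acc_pos f i & Forall (computable C) ts].

(* C has the properties demanded of C_U *)
Definition is_CU (U : rule -> Prop) (C : mterm -> Prop) : Prop :=
  rc_set U C /\
  forall s, C s <->
    [/\ base_term s,
        sn (fun t u => step U t u \/ acc_step C t u) s
      & forall f ss i si, steps U s (apps (Fun f) ss) ->
          acc_pos f i -> onth ss i = Some si -> computable C si].

(* [B Z i] stands for the condition Z : i.+1, i.e. counts arguments from 0 *)
Definition mconds : Type := mvar A -> nat -> Prop.

Definition respects (gamma : msubst) (B : mconds) : Prop :=
  forall Z i t xs u, B Z i -> on_mvar gamma Z = Some t ->
    t = lams xs u -> uniq xs -> ~~ is_lam u ->
    size xs <= i \/ exists2 x, onth xs i = Some x & x \in fv u.

(* [brsm B s t] is s unrhd_B t *)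
Inductive brsm (B : mconds) : mterm -> mterm -> Prop :=
| brsm_head t ss : brsm B (apps t ss) t
| brsm_lam x u t : brsm B u t -> brsm B (lam x u) t
| brsm_beta x u s0 ss t :
    brsm B (apps (vsubst [:: x] [:: s0] u) ss) t ->
    brsm B (apps (lam x u) (s0 :: ss)) t
| brsm_arg a ss i si t :
    is_lam a || is_mapp a || is_atom a ->
    onth ss i = Some si -> brsm B si t -> brsm B (apps a ss) t
| brsm_marg Z ts ss i ti t :
    B Z i -> onth ts i = Some ti -> brsm B ti t ->
    brsm B (apps (MApp Z ts) ss) t.

Record dp : Type := DP {
  dlhs : mterm;
  drhs : mterm;
  dconds : mconds;
  dp_typed : (exists sigma, typed dlhs sigma) /\ (exists tau, typed drhs tau);
  dp_closed : closed dlhs;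
  dp_pattern : pattern dlhs;
  dp_head : exists f ls, dlhs = apps (Fun f) ls /\ symbol_arity f <= size ls
}.

Definition collapsing (rho : dp) : Prop :=
  exists Z ss ts, drhs rho = apps (MApp Z ss) ts.

Definition non_collapsing (P : dp -> Prop) : Prop :=
  forall rho, P rho -> ~ collapsing rho.

Definition sharp (s : mterm) : mterm :=
  if spine_head s is Fun (inl f) then
    if size (spine_args s) == arity f then
      if insub f is Some g then apps (Fun (inr g)) (spine_args s) else s
    else s
  else s.

(* None stands for beta *)
Record chain_data : Type := ChainData {
  crho : nat -> option dp;
  csrc : nat -> mterm;
  ctgt : nat -> mterm
}.

Definition beta_step (s t : mterm) : Prop :=
  exists x u v ws, s = apps (lam x u) (v :: ws) /\
    if ws is [::] then
      exists q, [/\ subterm_avoiding (x :: fv v) u q, x \in fv q, q <> FVar x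
                  & t = vsubst [:: x] [:: v] (sharp q)]
    else t = apps (vsubst [:: x] [:: v] u) ws.

(* gamma has domain FMV(l), FMV(p), FV(p), and maps FV(p) to pairwise distinct
   variables that do not occur in any gamma(Z) *)
Definition dp_subst (rho : dp) (gamma : msubst) : Prop :=
  [/\ wf_msubst gamma,
      forall Z, on_mvar gamma Z <> None <->
                Z \in fmv (dlhs rho) ++ fmv (drhs rho),
      forall x, x \notin fv (drhs rho) -> on_var gamma x = FVar x,
      forall x, x \in fv (drhs rho) ->
        exists2 y, on_var gamma x = FVar y &
                   forall Z t, on_mvar gamma Z = Some t -> y \notin fv t
    & {in fv (drhs rho) &, injective (on_var gamma)}].

Definition dp_target (p : mterm) (gamma : msubst) (t : mterm) : Prop :=
  match p with
  | App _ _ | Fun (inr _) => t = subst gamma p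
  | MApp Z us =>
      exists g xs w v,
        [/\ on_mvar gamma Z = Some g, uniq xs,
            forall x, x \in xs -> x \notin fv g,
            Forall2 (fun x u => typed (subst gamma u) (vty x)) xs us
          & w = approx_inst g (map FVar xs)] /\
        [/\ subterm_avoiding (xs ++ flatten (map (fv \o subst gamma) us)) w v,
            ~~ is_var v, has (mem xs) (fv v)
          & t = vsubst xs (map (subst gamma) us) (sharp v)]
  | _ => False
  end.

Definition dp_step (rho : dp) (s t : mterm) : Prop :=
  exists gamma,
    [/\ dp_subst rho gamma, respects gamma (dconds rho),
        s = subst gamma (dlhs rho) & dp_target (drhs rho) gamma t].

Definition linked (R : rule -> Prop) (t s : mterm) : Prop :=
  t = s \/
  exists f us ws,
    [/\ t = apps (Fun f) us, s = apps (Fun f) ws & Forall2 (steps R) us ws].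

Definition chain (P : dp -> Prop) (R : rule -> Prop) (c : chain_data) : Prop :=
  forall i,
    [/\ is_term (csrc c i), is_term (ctgt c i),
        if crho c i is Some rho then P rho /\ dp_step rho (csrc c i) (ctgt c i)
        else beta_step (csrc c i) (ctgt c i)
      & linked R (ctgt c i) (csrc c i.+1)].

Definition minimal_chain (R : rule -> Prop) (c : chain_data) : Prop :=
  forall i t, strict_subterm (ctgt c i) t -> terminating R t.

(* [formative R s l gamma]: there is an l-formative reduction s ->* l gamma *)
Inductive formative (R : rule -> Prop) : mterm -> mterm -> msubst -> Prop :=
| formative_any s l gamma :
    ~~ (fully_extended l && linear l) -> steps R s (subst gamma l) ->
    formative R s l gamma
| formative_mapp Z xs gamma :
    uniq xs -> size xs = marity Z ->
    formative R (subst gamma (MApp Z (map FVar xs))) (MApp Z (map FVar xs)) gamma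
| formative_app a ss ls gamma :
    is_atom a -> subst gamma a = a ->
    Forall2 (fun s l => formative R s l gamma) ss ls ->
    formative R (apps a ss) (apps a ls) gamma
| formative_lam x s l gamma :
    on_var gamma x = FVar x ->
    (forall y, y \in fv l -> y != x -> x \notin fv (on_var gamma y)) ->
    (forall Z t, Z \in fmv l -> on_mvar gamma Z = Some t -> x \notin fv t) ->
    formative R s l gamma -> formative R (lam x s) (lam x l) gamma
| formative_beta x u v ws l gamma :
    formative R (apps (vsubst [:: x] [:: v] u) ws) l gamma ->
    formative R (apps (lam x u) (v :: ws)) l gamma
| formative_rule s l gamma rho (Zs : seq (mvar A)) delta :
    ~~ is_mapp l -> R rho ->
    uniq Zs -> (forall Z, Z \in Zs -> Z \notin fmv (rlhs rho)) ->
    let ext r := apps r (map (fun Z => MApp Z [::]) Zs) in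
    (exists sigma, typed (ext (rlhs rho)) sigma) ->
    wf_msubst delta -> covers delta (ext (rlhs rho)) ->
    formative R s (ext (rlhs rho)) delta ->
    formative R (subst delta (ext (rrhs rho))) l gamma ->
    formative R s l gamma.

Definition formative_chain (R : rule -> Prop) (c : chain_data) : Prop :=
  forall i rho, crho c i.+1 = Some rho ->
    exists gamma,
      [/\ wf_msubst gamma, covers gamma (dlhs rho),
          csrc c i.+1 = subst gamma (dlhs rho)
        & formative R (ctgt c i) (dlhs rho) gamma].

Definition computable_chain (U R : rule -> Prop) (c : chain_data) : Prop :=
  (forall s t, step R s t -> step U s t) /\
  exists2 C, is_CU U C &
    forall i, exists rho gamma,
      [/\ crho c i = Some rho, wf_msubst gamma,
          csrc c i = subst gamma (dlhs rho), ctgt c i = subst gamma (drhs rho)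
        & forall B v xs, brsm B (drhs rho) v -> respects gamma B ->
            uniq xs -> xs =i fv v -> computable C (subst gamma (lams xs v))].

Inductive min_flag : Type :=
| Minimal
| Arbitrary
| Computable of (rule -> Prop).

Inductive form_flag : Type := Formative | All.

Record dp_problem : Type := DPProblem {
  pairs : dp -> Prop;
  rules : rule -> Prop;
  mflag : min_flag;
  fflag : form_flag
}.

Definition finite (M : dp_problem) : Prop :=
  ~ exists c, [/\ chain (pairs M) (rules M) c,
      match mflag M with
      | Minimal => minimal_chain (rules M) c
      | Arbitrary => True
      | Computable U => computable_chain U (rules M) c
      end
    & if fflag M is Formative then formative_chain (rules M) c else True].

Definition infinite (M : dp_problem) : Prop :=
  ~ finite M \/ ~ (forall s, is_term s -> terminating (rules M) s).

Inductive proc_result : Type :=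
| NO
| Problems of (dp_problem -> Prop).

Definition sound (Proc : dp_problem -> proc_result) : Prop :=
  forall M Q, Proc M = Problems Q -> (forall M', Q M' -> finite M') -> finite M.

Definition complete (Proc : dp_problem -> proc_result) : Prop :=
  forall M,
    match Proc M with
    | NO => infinite M
    | Problems Q => (exists2 M', Q M' & infinite M') -> infinite M
    end.

(* The values of nu outside heads(P) are irrelevant; as usual, nu counts
   arguments from 1. [projects nu s u] is: nubar(s) is well-defined, and is u *)
Definition projects (nu : symbol -> nat) (s u : mterm) : Prop :=
  exists f ss,
    [/\ s = apps (Fun f) ss, 1 <= nu f <= size ss
      & onth ss (nu f).-1 = Some u].

Definition projection_function (nu : symbol -> nat) (P : dp -> Prop) : Prop :=
  forall rho, P rho ->
    (exists u, projects nu (dlhs rho) u) /\ (exists v, projects nu (drhs rho) v).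

Definition subterm_criterion (P P1 P2 : dp -> Prop) (nu : symbol -> nat) :
    Prop :=
  [/\ (forall rho, P rho <-> P1 rho \/ P2 rho) /\
      (forall rho, ~ (P1 rho /\ P2 rho)),
      non_collapsing P,
      projection_function nu P,
      forall rho, P1 rho -> exists u v,
        [/\ projects nu (dlhs rho) u, projects nu (drhs rho) v
          & strict_subterm u v]
    & forall rho, P2 rho -> exists u,
        projects nu (dlhs rho) u /\ projects nu (drhs rho) u].

Definition subterm_applicable (M : dp_problem) (P2 : dp -> Prop) : Prop :=
  (mflag M = Minimal \/ exists U, mflag M = Computable U) /\
  exists P1 nu, subterm_criterion (pairs M) P1 P2 nu.

Definition singleton (M : dp_problem) : proc_result :=
  Problems (fun M' => M' = M).

(* P1, P2 and nu are not unique for a given problem, so this describes the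
   processor obtained from any way of choosing them *)
Definition subterm_processor (Proc : dp_problem -> proc_result) : Prop :=
  forall M,
    (exists2 P2, subterm_applicable M P2 &
       Proc M = singleton (DPProblem P2 (rules M) (mflag M) (fflag M))) \/
    (~ (exists P2, subterm_applicable M P2) /\ Proc M = singleton M).

End AFSM.

(* Main.v *)
(* Completeness holds because a chain over P2 is a chain over P. For soundness,
   P being non-collapsing, a chain that leaves [beta] never returns to it, and
   the projected arguments then form a sequence whose consecutive elements are
   related by R-reductions and by subterm steps, the latter strict at every use
   of P1. Subterm steps postpone over reductions, so if the projections are
   terminating then P1 is used finitely often, and a tail of the chain is a chain
   over P2. Termination of a projection is immediate for minimal chains; for
   computable chains it holds because the projected argument of a right-hand side
   is among the subterms required to be computable, and computable terms
   terminate. *)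

From Stdlib Require Import List Relations Wellfounded Classical.
From mathcomp Require Import all_boot zify.
Require Import Defs.

Set Implicit Arguments.
Unset Strict Implicit.
Unset Printing Implicit Defensive.

(** * Syntax and substitution *)

Section Terms.

Context {A : signature}.
Implicit Types (s t u v : mterm A) (us : seq (mterm A)) (gamma : msubst A).
Implicit Types (x y : var A).

(** The generated induction principle gives no hypothesis on the arguments listed in [MApp]; the
    inner induction on that list supplies it as a [Forall]. *)
Lemma mterm_nested_ind (P : mterm A -> Prop) :
  (forall n, P (BVar A n)) -> (forall x, P (FVar x)) ->
  (forall f, P (Fun f)) -> (forall s t, P s -> P t -> P (App s t)) ->
  (forall sigma s, P s -> P (Lam sigma s)) ->
  (forall Z ss, Forall P ss -> P (MApp Z ss)) ->
  forall s, P s.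
Proof.
move=> Pb Px Pf Pa Pl Pm; fix IH 1; case=> [n|x|f|s t|sigma s|Z ss].
- exact: Pb.
- exact: Px.
- exact: Pf.
- by apply: Pa; apply: IH.
- by apply: Pl; apply: IH.
- by apply: Pm; elim: ss => [|s ss IHss]; constructor.
Qed.

(** Indices pointing outside [s] stay below [k]; at [k = 0] there are no dangling indices, as in the
    named syntax. *)
Fixpoint locally_closed k s : bool :=
  match s with
  | BVar n => n < k
  | FVar _ | Fun _ => true
  | App s t => locally_closed k s && locally_closed k t
  | Lam _ s => locally_closed k.+1 s
  | MApp _ ss => all (locally_closed k) ss
  end.

(** A measure for strict subterms that ignores names and indices, so that binding a variable does
    not change it. *)
Fixpoint msize s : nat :=
  match s with
  | BVar _ | FVar _ | Fun _ => 1
  | App s t => (msize s + msize t).+1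
  | Lam _ s => (msize s).+1
  | MApp _ ss => (sumn (map msize ss)).+1
  end.

Lemma msize_close k x s : msize (close k x s) = msize s.
Proof.
elim/mterm_nested_ind: s k => //=.
- by move=> y k; case: eqP.
- by move=> s t IHs IHt k; rewrite IHs IHt.
- by move=> sigma s IH k; rewrite IH.
- move=> Z ss IH k; congr _.+1.
  by elim: IH => //= s {}ss -> _ ->.
Qed.

Lemma fmv_close k x s : fmv (close k x s) = fmv s.
Proof.
elim/mterm_nested_ind: s k => //=.
- by move=> y k; case: eqP.
- by move=> s t IHs IHt k; rewrite IHs IHt.
- move=> Z ss IH k; congr (_ :: _).
  by elim: IH => //= s {}ss -> _ ->.
Qed.

Lemma mem_fv_close k x s : fv (close k x s) =i [pred y | (y \in fv s) && (y != x)].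
Proof.
move=> z; rewrite !inE; elim/mterm_nested_ind: s k => //=.
- move=> y k; rewrite inE; case: (eqVneq y x) => [->|yx] /=.
    by rewrite in_nil; case: eqP.
  by rewrite inE; case: (eqVneq z y) => [->|_] //=; rewrite yx.
- by move=> s t IHs IHt k; rewrite !mem_cat IHs IHt andb_orl.
- move=> Z ss IH k.
  by elim: IH => //= s {}ss Hs _ IH; rewrite !mem_cat Hs IH andb_orl.
Qed.

Lemma close_id k x s : locally_closed k s -> x \notin fv s -> close k x s = s.
Proof.
elim/mterm_nested_ind: s k => //=.
- by move=> n k ->.
- by move=> y k _; rewrite inE eq_sym => /negbTE ->.
- move=> s t IHs IHt k /andP[cs ct]; rewrite mem_cat negb_or => /andP[xs xt].
  by rewrite IHs // IHt.
- by move=> sigma s IH k cs xs; rewrite IH.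
- move=> Z ss IH k cs xs; congr MApp.
  elim: IH cs xs => //= s {}ss Hs _ IH /andP[cs css].
  by rewrite mem_cat negb_or => /andP[xs xss]; rewrite Hs // IH.
Qed.

(** Closing raises the indices from [k] on, so [BVar k] in the result can only come from [x]. *)
Lemma close_inj k x : injective (close k x).
Proof.
move=> s; elim/mterm_nested_ind: s k => [n|y|f|s t IHs IHt|sigma s IH|Z ss IH] k.
- case=> [m|z|g|s2 t2|tau s2|Z2 ss2] //=.
    by case: ltnP => ?; case: ltnP => ? [?]; congr BVar; lia.
  by case: eqP => // _; case: ltnP => ? [?]; lia.
- case=> [m|z|g|s2 t2|tau s2|Z2 ss2] //=; try by case: eqP.
    by case: eqP => // _; case: ltnP => ? [?]; lia.
  by case: eqP => [->|?]; case: eqP => [->|?] // [->].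
- by case=> [m|z|g|s2 t2|tau s2|Z2 ss2] //=; case: eqP.
- case=> [m|z|g|s2 t2|tau s2|Z2 ss2] //=; try by case: eqP.
  by move=> [/IHs-> /IHt->].
- case=> [m|z|g|s2 t2|tau s2|Z2 ss2] //=; try by case: eqP.
  by move=> [-> /IH->].
- case=> [m|z|g|s2 t2|tau s2|Z2 ss2] //=; try by case: eqP.
  move=> [-> E]; congr MApp.
  elim: IH ss2 E => [|s {}ss Hs _ IH] [|s2 ss2] //= [/Hs-> /IH->] //.
Qed.

Lemma locally_closed_close k x s :
  locally_closed k.+1 (close k x s) = locally_closed k s.
Proof.
elim/mterm_nested_ind: s k => //=.
- by move=> n k; case: (ltnP n k) => ? /=; lia.
- by move=> y k; case: eqP => _ //=; rewrite ltnSn.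
- by move=> s t IHs IHt k; rewrite IHs IHt.
- by move=> Z ss IH k; elim: IH => //= s {}ss -> _ ->.
Qed.

(** No typing rule covers a dangling index: indices arise only by closing in [lam], and the empty
    [fmv] excludes meta-variable applications. *)
Lemma locally_closed_term s sigma : term_of s sigma -> locally_closed 0 s.
Proof.
case=> ty_s; elim: ty_s => //= [{}s t sig tau _ IHs _ IHt|x {}s tau _ IH].
- by case E: (fmv s) => //= F; rewrite IHs // IHt.
- by rewrite fmv_close locally_closed_close.
Qed.

(** * Commutation of binding with lifting and instantiation *)

Lemma close_lift c j k x s :
  c <= k -> close (j + k) x (lift c j s) = lift c j (close k x s).
Proof.
elim/mterm_nested_ind: s c k => //=.
- move=> n c k ck; congr BVar.
  by case: (ltnP n c) => ?; case: (ltnP n k) => ?; do 2 case: ltnP => ?; lia.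
- move=> y c k ck; case: eqP => //= _; congr BVar; case: ltnP => ?; lia.
- by move=> s t IHs IHt c k ck; rewrite IHs // IHt.
- by move=> sigma s IH c k ck; rewrite -addnS IH.
- move=> Z ss IH c k ck; congr MApp.
  by elim: IH => //= s {}ss Hs _ ->; rewrite Hs.
Qed.

(** Entries of [us] are lifted by [j] when inserted under [j] binders, so binding [x] at depth
    [j + k] outside amounts to depth [k] inside each entry. Local closedness leaves no further index
    that could be shifted. *)
Lemma close_inst j k x us s :
  locally_closed (j + size us) s -> x \notin fv s ->
  close (j + k) x (inst j us s) = inst j (map (close k x) us) s.
Proof.
elim/mterm_nested_ind: s j k => //=.
- move=> n j k nb _; rewrite size_map nb.
  case: ltnP => nj /=; first by rewrite ltn_addr.
  rewrite close_lift // (nth_map (BVar A n)) //; lia.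
- by move=> y j k _; rewrite inE eq_sym => /negbTE ->.
- move=> s t IHs IHt j k /andP[cs ct]; rewrite mem_cat negb_or => /andP[xs xt].
  by rewrite IHs // IHt.
- by move=> sigma s IH j k cs xs; rewrite -addSn IH.
- move=> Z ss IH j k cs xs; congr MApp.
  elim: IH cs xs => //= s {}ss Hs _ IH /andP[cs css].
  by rewrite mem_cat negb_or => /andP[xs xss]; rewrite Hs // IH.
Qed.

(** * Variables and indices of applications, lifts and eta-expansions *)

Lemma fv_apps s ts : fv (apps s ts) = fv s ++ flatten (map (@fv A) ts).
Proof.
by elim: ts s => [|t ts IH] s /=; rewrite ?cats0 // IH /= catA.
Qed.

Lemma fmv_apps s ts : fmv (apps s ts) = fmv s ++ flatten (map (@fmv A) ts).
Proof.
by elim: ts s => [|t ts IH] s /=; rewrite ?cats0 // IH /= catA.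
Qed.

Lemma locally_closed_apps k s ts :
  locally_closed k (apps s ts) = locally_closed k s && all (locally_closed k) ts.
Proof.
by elim: ts s => [|t ts IH] s /=; rewrite ?andbT // IH /= andbA.
Qed.

Lemma fv_lift c d s : fv (lift c d s) = fv s.
Proof.
elim/mterm_nested_ind: s c => //=.
- by move=> s t IHs IHt c; rewrite IHs IHt.
- by move=> Z ss IH c; elim: IH => //= s {}ss -> _ ->.
Qed.

Lemma fmv_lift c d s : fmv (lift c d s) = fmv s.
Proof.
elim/mterm_nested_ind: s c => //=.
- by move=> s t IHs IHt c; rewrite IHs IHt.
- by move=> Z ss IH c; congr cons; elim: IH => //= s {}ss -> _ ->.
Qed.

Lemma locally_closed_lift c d k s :
  locally_closed k s -> locally_closed (k + d) (lift c d s).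
Proof.
elim/mterm_nested_ind: s c k => //=.
- by move=> n c k nk; case: (ltnP n c) => ?; lia.
- by move=> s t IHs IHt c k /andP[cs ct]; rewrite IHs // IHt.
- by move=> sigma s IH c k cs; rewrite -addSn IH.
- move=> Z ss IH c k cs.
  by elim: IH cs => //= s {}ss Hs _ IH /andP[cs css]; rewrite Hs // IH.
Qed.

Lemma flatten_BVar (T : Type) (f : mterm A -> seq T) (ns : seq nat) :
  (forall n, f (BVar A n) = [::]) -> flatten (map f (map (BVar A) ns)) = [::].
Proof. by move=> fB; elim: ns => //= n ns ->; rewrite fB. Qed.

Lemma strip_not_lam e s :
  ~~ is_lam s ->
  strip e.+1 s = apps (lift 0 e.+1 s) (map (BVar A) (rev (iota 0 e.+1))).
Proof. by case: s. Qed.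

Lemma fv_strip e s : fv (strip e s) = fv s.
Proof.
elim: e s => [|e IH] s //.
have [|/strip_not_lam->] := boolP (is_lam s); first by case: s => // sigma s _ /=.
by rewrite fv_apps fv_lift flatten_BVar // cats0.
Qed.

Lemma fmv_strip e s : fmv (strip e s) = fmv s.
Proof.
elim: e s => [|e IH] s //.
have [|/strip_not_lam->] := boolP (is_lam s); first by case: s => // sigma s _ /=.
by rewrite fmv_apps fmv_lift flatten_BVar // cats0.
Qed.

Lemma locally_closed_strip e k s :
  locally_closed k s -> locally_closed (k + e) (strip e s).
Proof.
have bvars j m : all (locally_closed (j + m)) (map (BVar A) (rev (iota 0 m))).
  rewrite all_map; apply/allP => n; rewrite mem_rev mem_iota /=; lia.
elim: e k s => [|e IH] k s cs; first by rewrite addn0.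
have [|/strip_not_lam->] := boolP (is_lam s).
  by case: s cs => // sigma s cs _; rewrite addnS -addSn; apply: IH.
by rewrite locally_closed_apps locally_closed_lift ?bvars.
Qed.

Lemma close_approx_inst k x t us :
  locally_closed 0 t -> x \notin fv t ->
  close k x (approx_inst t us) = approx_inst t (map (close k x) us).
Proof.
move=> ct xt; rewrite /approx_inst -[in LHS](add0n k) close_inst ?fv_strip //.
  by rewrite map_rev size_map.
by rewrite size_rev; apply: locally_closed_strip.
Qed.

(** * Substitution under named binders *)

Definition rename_var gamma x y : msubst A :=
  MSubst (fun z => if z == x then FVar y else on_var gamma z) (on_mvar gamma).

Lemma locally_closed_mono j k s :
  j <= k -> locally_closed j s -> locally_closed k s.
Proof.
elim/mterm_nested_ind: s j k => //=.
- by move=> n j k ? ?; lia.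
- by move=> s t IHs IHt j k jk /andP[/IHs-> // /IHt->].
- by move=> sigma s IH j k jk; apply: IH.
- move=> Z ss IH j k jk.
  by elim: IH => //= s {}ss Hs _ IH /andP[/Hs-> // /IH->].
Qed.

Lemma close_subst k x y gamma s :
  {in fv s, forall z, z != x ->
     locally_closed 0 (on_var gamma z) /\ y \notin fv (on_var gamma z)} ->
  {in fmv s, forall Z t, on_mvar gamma Z = Some t ->
     locally_closed 0 t /\ y \notin fv t} ->
  close k y (subst (rename_var gamma x y) s) = subst gamma (close k x s).
Proof.
elim/mterm_nested_ind: s k => //=.
- move=> z k gx _; case: eqP => [_|/eqP zx] /=; first by rewrite eqxx.
  have [|c f] := gx z _ zx; first by rewrite inE.
  by apply: close_id => //; apply: locally_closed_mono c.
- move=> s t IHs IHt k gv gm.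
  rewrite IHs ?IHt // => z zs; first [apply: gv | apply: gm];
    by rewrite mem_cat zs ?orbT.
- by move=> sigma s IH k gv gm; rewrite IH.
- move=> Z ss IH k gv gm.
  have E : map (close k y) (map (subst (rename_var gamma x y)) ss) =
      map (subst gamma) (map (close k x) ss).
    have {}gm : {in flatten (map (@fmv A) ss), forall Z t,
        on_mvar gamma Z = Some t -> locally_closed 0 t /\ y \notin fv t}.
      by move=> Z' Zss; apply: gm; rewrite inE Zss orbT.
    elim: IH gv gm => //= s {}ss Hs _ IH gv gm.
    rewrite Hs ?IH // => z zs; first [apply: gv | apply: gm];
      by rewrite mem_cat zs ?orbT.
  case gZ: (on_mvar gamma Z) => [t|] /=; last by rewrite E.
  have [|ct yt] := gm Z _ _ gZ; first by rewrite inE eqxx.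
  by rewrite close_approx_inst // E.
Qed.

Lemma subst_lam x y gamma s :
  vty y = vty x ->
  {in fv s, forall z, z != x ->
     locally_closed 0 (on_var gamma z) /\ y \notin fv (on_var gamma z)} ->
  {in fmv s, forall Z t, on_mvar gamma Z = Some t ->
     locally_closed 0 t /\ y \notin fv t} ->
  subst gamma (lam x s) = lam y (subst (rename_var gamma x y) s).
Proof. by move=> xy gv gm; rewrite /lam /= close_subst // xy. Qed.

Lemma eq_subst_var g1 g2 m s :
  {in fv s, g1 =1 g2} -> subst (MSubst g1 m) s = subst (MSubst g2 m) s.
Proof.
elim/mterm_nested_ind: s => //=.
- by move=> x; apply; rewrite inE.
- move=> s t IHs IHt E.
  by rewrite IHs ?IHt // => z zs; apply: E; rewrite mem_cat zs ?orbT.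
- by move=> sigma s IH /IH->.
- move=> Z ss IH E.
  suff -> : map (subst (MSubst g1 m)) ss = map (subst (MSubst g2 m)) ss by [].
  elim: IH E => //= s {}ss Hs _ IH E.
  by rewrite Hs ?IH // => z zs; apply: E; rewrite mem_cat zs ?orbT.
Qed.

(** * Subterms *)

Lemma subterm_trans s t u : subterm s t -> subterm t u -> subterm s u.
Proof.
elim=> // [x {}s {}t xN _ IH|s1 s2 {}t _ IH|s1 s2 {}t _ IH] tu.
- by apply: subterm_lam => //; apply: IH.
- by apply: subterm_appl; apply: IH.
- by apply: subterm_appr; apply: IH.
Qed.

Lemma subterm_msize s t : subterm s t -> s = t \/ msize t < msize s.
Proof.
elim=> [{}s|x {}s {}t _ _ IH|s1 s2 {}t _ IH|s1 s2 {}t _ IH]; first by left.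
all: by right=> /=; rewrite ?msize_close; case: IH => [->|]; lia.
Qed.

Lemma subterm_msize_le s t : subterm s t -> msize t <= msize s.
Proof. by case/subterm_msize => [->|/ltnW]. Qed.

Lemma strict_subterm_msize s t : strict_subterm s t -> msize t < msize s.
Proof. by case=> /subterm_msize[]. Qed.

Lemma strict_subtermP s t :
  subterm s t -> msize t < msize s -> strict_subterm s t.
Proof. by move=> st lt; split=> // E; rewrite E ltnn in lt. Qed.

(** [step_lam] works for every name, in particular for those chosen along the path to the
    subterm. *)
Lemma step_under_subterm (R : rule A -> Prop) s t u :
  subterm s t -> step R t u -> exists2 s', step R s s' & subterm s' u.
Proof.
elim=> [{}s|x {}s {}t xN _ IH|s1 s2 {}t _ IH|s1 s2 {}t _ IH] st.
- by exists u => //; apply: subterm_refl.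
- have [s' ss' s'u] := IH st.
  by exists (lam x s'); [apply: step_lam|apply: subterm_lam].
- have [s' ss' s'u] := IH st.
  by exists (App s' s2); [apply: step_appl|apply: subterm_appl].
- have [s' ss' s'u] := IH st.
  by exists (App s1 s'); [apply: step_appr|apply: subterm_appr].
Qed.

Lemma terminating_subterm (R : rule A -> Prop) s t :
  terminating R s -> subterm s t -> terminating R t.
Proof.
move=> sn_s; elim: sn_s t => {}s _ IH t st; constructor=> u tu.
by have [s' ss' s'u] := step_under_subterm st tu; apply: IH s'u.
Qed.

Definition step_or_subterm (R : rule A -> Prop) s t :=
  step R s t \/ strict_subterm s t.

(** Outer induction on the termination of [s], inner induction on the size of its subterm [t]: a
    reduction of [t] lifts to one of [s], and a subterm step decreases the size. *)
Lemma sn_step_or_subterm (R : rule A -> Prop) s :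
  terminating R s -> sn (step_or_subterm R) s.
Proof.
move=> sn_s; suff sub t : subterm s t -> sn (step_or_subterm R) t.
  exact: sub (subterm_refl _ _).
elim: sn_s t => {}s _ IHs t.
have [n] := ubnP (msize t); elim: n t => [t|n IHn t tn st].
  by rewrite ltn0.
constructor=> u [tu|tu].
  by have [s' ss' s'u] := step_under_subterm st tu; apply: IHs s'u.
apply: IHn; last by apply: subterm_trans st _; case: tu.
by apply: leq_trans (strict_subterm_msize tu) _.
Qed.

(* The binders on the path from [s] to [t] are renamed as prescribed by
   [gamma] when they bind a variable of [t], and freshly otherwise. *)
Lemma subterm_subst gamma s t :
  subterm s t -> closed s -> wf_msubst gamma ->
  {in fv t, forall x, exists2 y, on_var gamma x = FVar y &
     forall Z g, on_mvar gamma Z = Some g -> y \notin fv g} ->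
  {in fv t &, injective (on_var gamma)} ->
  subterm (subst gamma s) (subst gamma t) /\
  (s <> t -> msize (subst gamma t) < msize (subst gamma s)).
Proof.
move=> st cl_s [wfv wfm] fresh inj.
pose used := flatten [seq fv (on_var gamma x) | x <- fv t].
(* Generalised for the induction below binders: variables of [t] keep the images given by [gamma],
   while the others may have any images that avoid [used]. *)
have gen g :
    (forall z, locally_closed 0 (g z)) ->
    {in fv s, forall z, if z \in fv t then g z = on_var gamma z
      else {in used, forall y, y \notin fv (g z)}} ->
    subterm (subst (MSubst g (on_mvar gamma)) s) (subst gamma t) /\
    (s <> t -> msize (subst gamma t) < msize (subst (MSubst g (on_mvar gamma)) s)).
  elim: {s t cl_s} st @used fresh inj g => [s|x s t _ _ IH|s1 s2 t _ IH|s1 s2 t _ IH]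
    used fresh inj g lc_g gP.
  - suff -> : subst (MSubst g (on_mvar gamma)) s = subst gamma s.
      by split=> //; apply: subterm_refl.
    case: gamma {wfv wfm fresh inj} @used gP => h m used gP /=.
    by apply: eq_subst_var => z zs; have := gP z zs; rewrite zs.
  - have gPs z : z \in fv s -> z != x -> z \in fv (lam x s).
      by move=> zs zx; rewrite mem_fv_close inE zs.
    (* If [x] is free in [t], its name is dictated by [gamma]: injectivity and the avoidance of
       [used] keep it apart from the images of other variables, freshness from those of
       meta-variables. Otherwise any name outside all these lists works. *)
    have [y [xy y_t y_fv y_fmv]] : exists y, [/\ vty y = vty x,
        if x \in fv t then on_var gamma x = FVar y else y \notin used,
        {in fv s, forall z, z != x -> y \notin fv (g z)}
      & {in fmv s, forall Z v, on_mvar gamma Z = Some v -> y \notin fv v}].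
      case xt : (x \in fv t).
        have [y gx y_fmv] := fresh x xt; exists y; split=> //; last first.
        - by move=> Z _ v; apply: y_fmv.
        - move=> z zs zx; have := gP z (gPs z zs zx); case: ifP => [zt ->|_]; last first.
            by apply; apply/flatten_mapP; exists x; rewrite // gx inE.
          have [w gz _] := fresh z zt; rewrite gz inE; apply: contra zx => /eqP yw.
          by apply/eqP/inj; rewrite // gz gx yw.
        - by have [ty_y _] := wfv x; rewrite gx in ty_y; inversion ty_y.
      pose fvm Z := if on_mvar gamma Z is Some v then fv v else [::].
      have [y xy] := var_infinite (vty x) (used ++
        [seq w | z <- fv s, w <- fv (g z)] ++ [seq w | Z <- fmv s, w <- fvm Z]).
      rewrite !mem_cat !negb_or => /and3P[yu yg ym]; exists y; split=> //.
      - move=> z zs zx; apply: contra yg => yz.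
        by apply/allpairsPdep; exists z, y.
      - move=> Z Zs v gZ; apply: contra ym => yv.
        by apply/allpairsPdep; exists Z, y; rewrite /fvm gZ.
    rewrite (@subst_lam x y) //; last 2 first.
    + by move=> z zs zx; split=> //; apply: y_fv.
    + move=> Z Zs v gZ; split; last exact: y_fmv gZ.
      by have [/locally_closed_term] := wfm _ _ gZ.
    set g' := (rename_var _ x y).
    have [|z zs|sub _] := IH fresh inj (on_var g'); first by move=> z /=; case: eqP.
      rewrite /=; case: (eqVneq z x) => [->|zx]; last exact: gP (gPs _ zs zx).
      case: ifP y_t => // _ yu w wu; rewrite inE; apply: contraNneq yu => <-.
      exact: wu.
    split; first exact: subterm_lam.
    by move=> _; rewrite /= msize_close ltnS; apply: (subterm_msize_le sub).
  - have [//|z zs|sub _] := IH fresh inj g; first by apply: gP; rewrite mem_cat zs.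
    by split=> [|_]; [apply: subterm_appl|have := subterm_msize_le sub; rewrite /=; lia].
  - have [//|z zs|sub _] := IH fresh inj g; first by apply: gP; rewrite mem_cat zs orbT.
    by split=> [|_]; [apply: subterm_appr|have := subterm_msize_le sub; rewrite /=; lia].
case: gamma wfv {wfm fresh inj} @used gen => h m wfv used gen /=.
apply: (gen h) => z; first by have /locally_closed_term := wfv z.
(* Since [s] is closed, the condition on the images of its free variables is void. *)
by rewrite cl_s.
Qed.

(** * Application spines *)

Lemma apps_rcons s ts t : apps s (rcons ts t) = App (apps s ts) t.
Proof. exact: foldl_rcons. Qed.

Lemma subst_apps gamma s ts :
  subst gamma (apps s ts) = apps (subst gamma s) (map (subst gamma) ts).
Proof. by elim: ts s => //= t ts IH s; rewrite IH. Qed.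

Lemma spine_head_apps s ts : spine_head (apps s ts) = spine_head s.
Proof. by elim: ts s => //= t ts IH s; rewrite IH. Qed.

Lemma spine_args_apps s ts : ~~ is_app s -> spine_args (apps s ts) = ts.
Proof.
move=> ns; elim/last_ind: ts => [|ts t IH]; first by case: s ns.
by rewrite apps_rcons /= IH.
Qed.

Lemma apps_Fun_inj (f g : symbol A) ss ts :
  apps (Fun f) ss = apps (Fun g) ts -> f = g /\ ss = ts.
Proof.
move=> E; have := congr1 (@spine_head A) E; rewrite !spine_head_apps => -[->].
by have := congr1 (@spine_args A) E; rewrite !spine_args_apps.
Qed.

Lemma apps_inj_size s t ss ts :
  size ss = size ts -> apps s ss = apps t ts -> s = t /\ ss = ts.
Proof.
elim: ss s t ts => [|s' ss IH] s t [|t' ts] //= [/IH{}IH] /IH.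
by move=> [[-> ->] ->].
Qed.

Lemma subterm_apps s ts : subterm (apps s ts) s.
Proof.
elim/last_ind: ts => [|ts t IH]; first exact: subterm_refl.
by rewrite apps_rcons; apply: subterm_appl.
Qed.

Lemma strict_subterm_arg s ts i t :
  onth ts i = Some t -> strict_subterm (apps s ts) t.
Proof.
move=> ti; have {i ti} [st lt] : subterm (apps s ts) t /\ msize t < msize (apps s ts).
  elim: ts s i ti => [|t' ts IH] s [|i] //=; last exact: IH.
  move=> [<-]; have sub := subterm_apps (App s t') ts; split.
    by apply: subterm_trans sub _; apply: subterm_appr; apply: subterm_refl.
  by have /= := subterm_msize_le sub; lia.
exact: strict_subtermP.
Qed.

Lemma fv_arg s ts i t : onth ts i = Some t -> {subset fv t <= fv (apps s ts)}.
Proof.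
rewrite fv_apps => ti x xt; rewrite mem_cat; apply/orP; right.
by elim: ts i ti => [|t' ts IH] [|i] //= => [[->]|/IH{}IH]; rewrite mem_cat ?xt ?IH ?orbT.
Qed.

(** * Matching *)

Lemma inst_FVars_BVar j (ys : seq (var A)) n :
  let s := inst j (map (@FVar A) ys) (BVar A n) in
  [\/ s = BVar A n /\ n < j,
      exists2 y, s = FVar y & [/\ j <= n, n - j < size ys & y = nth y ys (n - j)]
    | s = BVar A (n - size ys) /\ j + size ys <= n].
Proof.
rewrite /= size_map; case: ltnP => nj; first by constructor 1.
case: ltnP => nys; last by constructor 3.
have lt : n - j < size ys by lia.
case E : ys lt => [|y0 ys'] // lt; rewrite -E in lt *; constructor 2.
exists (nth y0 ys (n - j)); last by split=> //; apply: set_nth_default.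
by rewrite (nth_map y0).
Qed.

(** Distinct names absent from both bodies faithfully record the indices they replace. Thus the body
    of a meta-variable's image can be read off from its application to distinct variables. *)
Lemma inst_FVar_inj j (ys : seq (var A)) s t :
  uniq ys -> {in ys, forall y, y \notin fv s} -> {in ys, forall y, y \notin fv t} ->
  inst j (map (@FVar A) ys) s = inst j (map (@FVar A) ys) t -> s = t.
Proof.
(* An instantiated index is an index or one of the [ys]; as [u] contains none of the [ys], it must
   itself be an index. *)
have BVar_other n (u : mterm A) k : {in ys, forall y, y \notin fv u} ->
    inst k (map (@FVar A) ys) (BVar A n) = inst k (map (@FVar A) ys) u ->
    exists m, u = BVar A m.
  move=> nu; case: (inst_FVars_BVar k ys n) => [[-> _]|[y -> [_ lt ey]]|[-> _]];
  case: u nu => [m|z|g|s1 s2|tau s'|Z ss] nu //=; try by exists m.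
  move=> [yz]; have /nu : y \in ys by rewrite ey mem_nth.
  by rewrite yz inE eqxx.
move=> uys; elim/mterm_nested_ind: s t j => [n|x|f|s1 s2 IH1 IH2|sigma s IH|Z ss IH] t j.
- move=> _ nt E; have [m Et] := BVar_other _ _ _ nt E; subst t; move: E.
  case: (inst_FVars_BVar j ys n) => [[-> ?]|[y -> [? ? ey]]|[-> ?]];
  case: (inst_FVars_BVar j ys m) => [[-> ?]|[z -> [? ? ez]]|[-> ?]] // [] E;
    try by congr BVar; lia.
  have /eqP : nth y ys (n - j) = nth y ys (m - j) by rewrite -ey E -ez.
  by rewrite nth_uniq // => /eqP ?; congr BVar; lia.
- move=> ns nt E; case: t nt E => [m|z|g|t1 t2|tau t|Z2 ts] nt E //.
  by have [] := BVar_other _ _ _ ns (esym E).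
- move=> ns nt E; case: t nt E => [m|z|g|t1 t2|tau t|Z2 ts] nt E //.
  by have [] := BVar_other _ _ _ ns (esym E).
- move=> ns nt E; case: t nt E => [m|z|g|t1 t2|tau t|Z2 ts] nt E //.
    by have [] := BVar_other _ _ _ ns (esym E).
  case: E => E1 E2; congr App; [apply: IH1 E1|apply: IH2 E2] => y yys.
  + by apply: contra (ns y yys); rewrite mem_cat => ->.
  + by apply: contra (nt y yys); rewrite mem_cat => ->.
  + by apply: contra (ns y yys); rewrite mem_cat orbC => ->.
  + by apply: contra (nt y yys); rewrite mem_cat orbC => ->.
- move=> ns nt E; case: t nt E => [m|z|g|t1 t2|tau t|Z2 ts] nt E //.
    by have [] := BVar_other _ _ _ ns (esym E).
  by case: E => -> /IH->.
- move=> ns nt E; case: t nt E => [m|z|g|t1 t2|tau t|Z2 ts] nt E //.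
    by have [] := BVar_other _ _ _ ns (esym E).
  case: E => -> E; congr MApp.
  elim: IH ts ns nt E => [|s {}ss Hs _ IH] [|t ts] //= ns nt [E1 E2].
  congr cons; [apply: Hs E1|apply: IH E2] => y yys.
  + by apply: contra (ns y yys); rewrite mem_cat => ->.
  + by apply: contra (nt y yys); rewrite mem_cat => ->.
  + by apply: contra (ns y yys); rewrite /= mem_cat orbC => ->.
  + by apply: contra (nt y yys); rewrite /= mem_cat orbC => ->.
Qed.

(* [gamma] and [delta] act alike on the meta-variable applications of [s]; being
   phrased through [strip], this does not require the type annotations of the
   two images to be compared. *)
Definition same_strips gamma delta := fix same s : Prop :=
  match s with
  | BVar _ | FVar _ | Fun _ => True
  | App s t => same s /\ same t
  | Lam _ s => same s
  | MApp Z ss =>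
      (exists t u, [/\ on_mvar gamma Z = Some t, on_mvar delta Z = Some u
                     & strip (size ss) t = strip (size ss) u]) /\
      foldr (fun s P => same s /\ P) True ss
  end.

Lemma same_strips_close gamma delta k x s :
  same_strips gamma delta s <-> same_strips gamma delta (close k x s).
Proof.
elim/mterm_nested_ind: s k => //=.
- by move=> y k; case: eqP.
- by move=> s t IHs IHt k; rewrite -IHs -IHt.
- move=> Z ss IH k; rewrite size_map.
  apply: and_iff_compat_l; elim: IH => //= s {}ss Hs _ IH.
  by rewrite -Hs IH.
Qed.

Lemma same_strips_lam gamma delta x s :
  same_strips gamma delta (lam x s) <-> same_strips gamma delta s.
Proof. by rewrite [in X in _ <-> X](same_strips_close _ _ 0 x). Qed.

Lemma same_strips_subterm gamma delta s t :
  subterm s t -> same_strips gamma delta s -> same_strips gamma delta t.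
Proof.
elim=> //= [x {}s {}t _ _ IH|s1 s2 {}t _ IH [/IH]|s1 s2 {}t _ IH [_ /IH]] //.
by move/same_strips_lam.
Qed.

(** [approx_inst] sees the image of a meta-variable only through [strip]. *)
Lemma same_strips_subst gamma delta s :
  same_strips gamma delta s -> {in fv s, on_var gamma =1 on_var delta} ->
  subst gamma s = subst delta s.
Proof.
elim/mterm_nested_ind: s => //=.
- by move=> x _; apply; rewrite inE.
- move=> s t IHs IHt [cs ct] E.
  by rewrite IHs ?IHt // => z zs; apply: E; rewrite mem_cat zs ?orbT.
- by move=> sigma s IH cs E; rewrite IH.
- move=> Z ss IH [[t [u [-> -> tu]]] css] E.
  rewrite /approx_inst !size_map tu; congr (inst 0 (rev _) _).
  elim: IH css E {tu} => //= s {}ss Hs _ IH [cs css] E.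
  by rewrite Hs ?IH // => z zs; apply: E; rewrite mem_cat zs ?orbT.
Qed.

Lemma same_strips_apps gamma delta s ts :
  same_strips gamma delta s -> Forall (same_strips gamma delta) ts ->
  same_strips gamma delta (apps s ts).
Proof.
move=> cs cts; elim: cts s cs => //= t {}ts ct _ IH s cs.
exact: IH.
Qed.

Lemma pattern_nested_ind (P : mterm A -> Prop) :
  (forall Z xs, uniq xs -> size xs = marity Z -> P (MApp Z (map (@FVar A) xs))) ->
  (forall x l, pattern l -> P l -> P (lam x l)) ->
  (forall a ls, is_atom a -> Forall P ls -> P (apps a ls)) ->
  forall l, pattern l -> P l.
Proof.
move=> Pm Pl Pa; fix IH 2 => l; case=> [Z xs uxs sxs|x {}l pl|a ls at_a pls].
- exact: Pm.
- by apply: Pl => //; apply: IH.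
- by apply: Pa => //; elim: pls => [|l' ls' pl _ IHls]; constructor=> //; apply: IH.
Qed.

Lemma wf_msubst_rename gamma x y :
  vty y = vty x -> wf_msubst gamma -> wf_msubst (rename_var gamma x y).
Proof.
move=> xy [wfv wfm]; split=> //= z; case: eqP => // ->; rewrite -xy; split=> //.
exact: typed_var.
Qed.

(** Supplies names for opening binders: [N] collects the free variables of all images of variables
    and meta-variables of [s]. *)
Lemma wf_msubst_fresh gamma s :
  wf_msubst gamma ->
  exists N : seq (var A), forall y, y \notin N ->
    {in fv s, forall z, locally_closed 0 (on_var gamma z) /\ y \notin fv (on_var gamma z)} /\
    {in fmv s, forall Z t, on_mvar gamma Z = Some t ->
       locally_closed 0 t /\ y \notin fv t}.
Proof.
move=> [wfv wfm]; pose fvm Z := if on_mvar gamma Z is Some v then fv v else [::].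
exists ([seq w | z <- fv s, w <- fv (on_var gamma z)] ++ [seq w | Z <- fmv s, w <- fvm Z]).
move=> y; rewrite mem_cat negb_or => /andP[yg ym]; split.
- move=> z zs; split; first exact: locally_closed_term (wfv z).
  by apply: contra yg => yz; apply/allpairsPdep; exists z, y.
- move=> Z Zs t gZ; split; first by have [/locally_closed_term] := wfm _ _ gZ.
  by apply: contra ym => yt; apply/allpairsPdep; exists Z, y; rewrite /fvm gZ.
Qed.

(** The invariant for going below the binders of a pattern: both substitutions open the bound
    variables with the same distinct names, fresh for the images of meta-variables. *)
Definition opens gamma delta s : Prop :=
  {in fv s, forall x, exists y, [/\ on_var gamma x = FVar y, on_var delta x = FVar y
    & {in fmv s, forall Z t, on_mvar gamma Z = Some t \/ on_mvar delta Z = Some t ->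
         y \notin fv t}]} /\
  {in fv s &, injective (on_var gamma)}.

Lemma opens_apps gamma delta s ts :
  opens gamma delta (apps s ts) -> Forall (opens gamma delta) ts.
Proof.
rewrite /opens fv_apps fmv_apps; elim: ts => [|t ts IH] /= [g_var inj]; constructor.
  split=> [x xt|x x' xt x't]; last by apply: inj; rewrite !mem_cat ?xt ?x't !orbT.
  have [|y [gx dx yt]] := g_var x; first by rewrite !mem_cat xt orbT.
  by exists y; split=> // Z Zt; apply: yt; rewrite !mem_cat Zt orbT.
have sub (T : eqType) (a b c : seq T) : {subset a ++ c <= a ++ b ++ c}.
  by move=> z; rewrite !mem_cat => /orP[]->; rewrite ?orbT.
apply: IH; split=> [x xt|x x' xt x't]; last by apply: inj; apply: sub.
have [|y [gx dx yt]] := g_var x; first exact: sub.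
by exists y; split=> // Z Zt; apply: yt; apply: sub.
Qed.

(** Turns the arguments of a pattern's meta-variable into the distinct fresh names that
    [inst_FVar_inj] asks for. *)
Lemma opens_FVars gamma delta s (xs : seq (var A)) :
  opens gamma delta s -> uniq xs -> {subset xs <= fv s} ->
  exists ys, [/\ map (on_var gamma) xs = map (@FVar A) ys,
    map (on_var delta) xs = map (@FVar A) ys, uniq ys
  & {in ys, forall y, (exists2 x, x \in xs & on_var gamma x = FVar y) /\
      {in fmv s, forall Z t, on_mvar gamma Z = Some t \/ on_mvar delta Z = Some t ->
         y \notin fv t}}].
Proof.
move=> [g_var inj]; elim: xs => [|x xs IH] /=; first by exists [::].
move=> /andP[xxs uxs] sub.
have [|ys [g_xs d_xs uys ysP]] := IH uxs.
  by move=> z zs; apply: sub; rewrite inE zs orbT.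
have xs_s : x \in fv s by apply: sub; rewrite inE eqxx.
have [y [gx dx yP]] := g_var x xs_s.
exists (y :: ys); rewrite /= gx dx g_xs d_xs uys andbT; split=> //.
  apply: contra xxs => /ysP[[z zxs gz] _]; suff -> : x = z by [].
  apply: inj => //; first by apply: sub; rewrite inE zxs orbT.
  by rewrite gx.
move=> z; rewrite inE => /orP[/eqP->|/ysP[[w wxs gw] zP]]; split=> //.
  by exists x; rewrite ?inE ?eqxx.
by exists w; rewrite ?inE ?wxs ?orbT.
Qed.

Lemma inst_FVars_not_mapp j (ys : seq (var A)) s :
  fmv s = [::] -> ~~ is_mapp (inst j (map (@FVar A) ys) s).
Proof.
case: s => // n _; case: (inst_FVars_BVar j ys n) => [[-> _]|[y -> _]|[-> _]] //.
Qed.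

(** Uniqueness of pattern matching: meta-variables are applied to distinct variables, opened alike
    by both substitutions, so equal instances determine equal bodies. *)
Lemma pattern_same_strips gamma delta l :
  pattern l -> wf_msubst gamma -> wf_msubst delta -> covers delta l ->
  opens gamma delta l -> subst gamma l = subst delta l ->
  same_strips gamma delta l.
Proof.
move=> pl; elim/pattern_nested_ind: pl gamma delta =>
  [Z xs uxs _|x {}l _ IH|a ls at_a IH] gamma delta wfg wfd cov op.
- have [|ys [g_xs d_xs uys ysP]] := opens_FVars op uxs.
    move=> x; rewrite /=; elim: (xs) => //= z zs IH.
    by rewrite !inE => /orP[->|/IH->]; rewrite ?orbT.
  have fvsub (g : msubst A) : map (subst g) (map (@FVar A) xs) = map (on_var g) xs.
    by rewrite -map_comp.
  have ZZ : Z \in fmv (MApp Z (map (@FVar A) xs)) by rewrite inE eqxx.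
  rewrite /= !fvsub g_xs d_xs.
  case dZ : (on_mvar delta Z) => [h|]; last by case: (cov Z ZZ).
  have [[_ h_fmv] _] := wfd.2 _ _ dZ.
  (* Were [gamma] undefined at [Z], the left side would be a meta-variable application, which no
     instance by variables of the body of the term [h] can be. *)
  case gZ : (on_mvar gamma Z) => [g|]; last first.
    rewrite /approx_inst -map_rev => E.
    have := @inst_FVars_not_mapp 0 (rev ys) (strip (size (map (@FVar A) ys)) h).
    by rewrite -E fmv_strip => /(_ h_fmv).
  have sys : size ys = size xs by rewrite -(size_map (@FVar A)) -g_xs size_map.
  rewrite /approx_inst -map_rev !size_map sys => E; split; last by elim: (xs).
  exists g, h; split=> //; apply: inst_FVar_inj E.
  + by rewrite rev_uniq.
  + move=> y; rewrite mem_rev fv_strip => /ysP[_ yP]; apply: (yP Z ZZ); by left.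
  + move=> y; rewrite mem_rev fv_strip => /ysP[_ yP]; apply: (yP Z ZZ); by right.
- have [N freshg] := wf_msubst_fresh l wfg.
  have [N' freshd] := wf_msubst_fresh l wfd.
  (* One name fresh for both substitutions opens the binder; it preserves [opens] and lets
     [close_inj] cancel the abstraction. *)
  have [y xy] := var_infinite (vty x) (N ++ N').
  rewrite mem_cat negb_or => /andP[/freshg[gv gm] /freshd[dv dm]].
  rewrite (@subst_lam x y gamma) ?(@subst_lam x y delta) //;
    try by move=> z zl _; first [apply: gv | apply: dv].
  move=> [/close_inj E]; apply/same_strips_lam.
  refine (IH (rename_var gamma x y) (rename_var delta x y) _ _ _ _ E).
  + exact: wf_msubst_rename.
  + exact: wf_msubst_rename.
  + by move=> Z Zl; apply: cov; rewrite /lam /= fmv_close.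
  + case: op; rewrite /lam /= fmv_close => op inj.
    have lamP z : z \in fv l -> z != x -> z \in fv (close 0 x l).
      by move=> zl zx; rewrite mem_fv_close inE zl.
    split=> [z zl|z z' zl z'l] /=.
      case: (eqVneq z x) => [_|zx]; last exact: op (lamP _ zl zx).
      exists y; split=> // Z Zl t [gZ|dZ]; first by have [] := gm Z Zl t gZ.
      by have [] := dm Z Zl t dZ.
    case: (eqVneq z x) => [->|zx]; case: (eqVneq z' x) => [->|z'x] //.
    * by move=> gz'; have [_] := gv z' z'l; rewrite -gz' inE eqxx.
    * by move=> gz; have [_] := gv z zl; rewrite gz inE eqxx.
    * by apply: inj; apply: lamP.
- rewrite !subst_apps => /apps_inj_size[|_ E]; first by rewrite !size_map.
  apply: same_strips_apps; first by case: a at_a {cov op E}.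
  have := opens_apps op; have {cov} : Forall (covers delta) ls.
    elim: ls cov {IH op E} => //= {}l ls IHl cov; constructor.
      by move=> Z Zl; apply: cov; rewrite fmv_apps /= !mem_cat Zl !orbT.
    apply: IHl => Z; rewrite fmv_apps mem_cat => Zls; apply: cov.
    rewrite fmv_apps /= !mem_cat; by case/orP: Zls => ->; rewrite ?orbT.
  elim: IH E {op} => //= {}l {}ls Hl _ IH [El Els] cov op.
  inversion_clear cov; inversion_clear op.
  by constructor; [apply: Hl|apply: IH].
Qed.

(** * Computability *)

Lemma sn_sub (r r' : mterm A -> mterm A -> Prop) s :
  (forall t u, r' t u -> r t u) -> sn r s -> sn r' s.
Proof. by move=> sub; elim=> {}s _ IH; constructor=> t /sub; apply: IH. Qed.

(** Rule instances are headed by a symbol and beta-redexes by an abstraction, so below a variable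
    head every step takes place inside an argument. *)
Lemma step_spine_head_var (U : rule A -> Prop) x s t :
  step U s t -> spine_head s = FVar x -> spine_head t = FVar x.
Proof.
elim=> //= {s t} rho delta _ _ _.
by have [f [ls ->]] := rule_head rho; rewrite subst_apps spine_head_apps.
Qed.

Lemma steps_spine_head_var (U : rule A -> Prop) x s t :
  steps U s t -> spine_head s = FVar x -> spine_head t = FVar x.
Proof.
elim=> [{}s {}t st|//|{}s u {}t _ IH1 _ IH2 /IH1/IH2//].
exact: step_spine_head_var st.
Qed.

(** The variable head excludes rule, beta and [acc_step] steps at the root; nested induction on the
    termination of [s] and of [t] covers the rest. *)
Lemma sn_var_app (U : rule A -> Prop) C x s t :
  spine_head s = FVar x -> terminating U s -> terminating U t ->
  sn (fun u v => step U u v \/ acc_step C u v) (App s t).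
Proof.
move=> head_s sn_s; elim: sn_s t head_s => {}s _ IHs t head_s sn_t.
elim: sn_t => {}t sn_t IHt; constructor=> u; case; last first.
  case=> [f [ss [i [si [ts [[E _ _] _]]]]]]; have := congr1 (@spine_head A) E.
  by rewrite spine_head_apps /= head_s.
move E : (App s t) => w st; case: st E.
- move=> rho delta _ _ _; have [f [ls ->]] := rule_head rho.
  by rewrite subst_apps => /(congr1 (@spine_head A)); rewrite spine_head_apps /= head_s.
- by move=> y s' t' [Es _]; rewrite Es in head_s.
- move=> s1 s' t1 ss' [? ?]; subst.
  exact: IHs ss' _ (step_spine_head_var ss' head_s) (Acc_intro _ sn_t).
- by move=> s1 t1 t' tt' [? ?]; subst; apply: IHt.
- by [].
Qed.

Lemma sn_var (U : rule A -> Prop) C x :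
  sn (fun u v => step U u v \/ acc_step C u v) (FVar x).
Proof.
constructor=> u; case; last first.
  case=> [f [ss [i [si [ts [[E _ _] _]]]]]]; have := congr1 (@spine_head A) E.
  by rewrite spine_head_apps.
move E : (FVar x) => w st.
case: st E => [rho delta _ _ _|? ? ? E|? ? ? _ E|? ? ? _ E|? ? ? _ E];
  try discriminate E.
have [f [ls ->]] := rule_head rho.
by rewrite subst_apps => /(congr1 (@spine_head A)); rewrite spine_head_apps.
Qed.

Lemma sn_var_apps (U : rule A -> Prop) C x ss :
  Forall (terminating U) ss ->
  sn (fun u v => step U u v \/ acc_step C u v) (apps (FVar x) ss).
Proof.
elim/last_ind: ss => [|ss s IH]; first by move=> _; apply: sn_var.
rewrite -cats1 => /Forall_app[sn_ss sn_s]; rewrite cats1 apps_rcons.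
apply: (@sn_var_app _ _ x); first by rewrite spine_head_apps.
  by apply: sn_sub (IH sn_ss) => t u; left.
by inversion sn_s.
Qed.

Lemma computable_at_term (C : mterm A -> Prop) sigma s :
  computable_at C sigma s -> term_of s sigma.
Proof. by case: sigma => [k|sigma tau] []. Qed.

(* Reducts are never required to be typed here, since the characterization of
   C_U makes [x ss] a member as soon as it has a base type and [ss] terminates:
   subject reduction is not needed. *)
Lemma computable_at_terminating (U : rule A -> Prop) C sigma :
  is_CU U C ->
  (forall s, computable_at C sigma s -> terminating U s) /\
  (forall x ss, term_of (apps (FVar x) ss) sigma -> Forall (terminating U) ss ->
     computable_at C sigma (apps (FVar x) ss)).
Proof.
move=> [[_ Csn _ _] CP]; elim: sigma => [k|sigma [sn1 var1] tau [sn2 var2]].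
  split=> [s [_ /Csn]//|x ss ty_s sn_ss]; split=> //; apply/CP; split.
  - by exists k.
  - exact: sn_var_apps.
  (* Reducts keep the head [x], so the condition on symbol-headed reducts holds vacuously. *)
  - move=> f ts i si /steps_spine_head_var; rewrite spine_head_apps => /(_ x erefl).
    by rewrite spine_head_apps.
split=> [s [ty_s s_comp]|x ss ty_s sn_ss].
  (* Variables of type [sigma] are computable by the induction hypothesis, so [s] is a subterm of a
     terminating application to a variable. *)
  have [x xsigma _] := var_infinite sigma [::].
  have cx : computable_at C sigma (FVar x).
    apply: (var1 x [::]) => //; split=> //; rewrite -xsigma; exact: typed_var.
  apply: terminating_subterm (sn2 _ (s_comp _ cx)) _.
  exact: (subterm_apps s [:: FVar x]).
split=> // t ct; rewrite -apps_rcons; apply: var2.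
  have [ty_t fmv_t] := computable_at_term ct; case: ty_s => ty_s fmv_s.
  by rewrite apps_rcons; split; [apply: typed_app ty_s ty_t|rewrite /= fmv_s].
rewrite -cats1; apply/Forall_app; split; first exact: sn_ss.
by constructor; [exact: sn1|exact: Forall_nil].
Qed.

Lemma computable_terminating (U : rule A -> Prop) C s :
  is_CU U C -> computable C s -> terminating U s.
Proof.
by move=> CU [sigma]; have [sn _] := computable_at_terminating sigma CU; apply: sn.
Qed.

(** * Projections along chains *)

Lemma projects_subst nu gamma s u :
  projects nu s u -> projects nu (subst gamma s) (subst gamma u).
Proof.
move=> [f [ss [-> nuf si]]]; exists f, (map (subst gamma) ss).
by rewrite subst_apps size_map; split=> //; rewrite onth_map si.
Qed.

Lemma projects_inj (nu : symbol A -> nat) s u v :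
  projects nu s u -> projects nu s v -> u = v.
Proof.
move=> [f [ss [-> _ si]]] [g [ts [/apps_Fun_inj[<- <-] _]]].
by rewrite si => -[].
Qed.

Lemma projects_strict_subterm (nu : symbol A -> nat) s u :
  projects nu s u -> strict_subterm s u.
Proof. by move=> [f [ss [-> _ si]]]; apply: strict_subterm_arg si. Qed.

Lemma projects_fv (nu : symbol A -> nat) s u :
  projects nu s u -> {subset fv u <= fv s}.
Proof. by move=> [f [ss [-> _ si]]]; apply: fv_arg si. Qed.

Lemma linked_projects (nu : symbol A -> nat) (R : rule A -> Prop) s t u v :
  linked R s t -> projects nu s u -> projects nu t v -> steps R u v.
Proof.
case=> [<- su /(projects_inj su) <-|]; first exact: rt_refl.
move=> [f [ss [ts [-> -> rs]]]] [g [ss' [/apps_Fun_inj[<- <-] _ si]]].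
move=> [h [ts' [/apps_Fun_inj[<- <-] _]]] ti.
elim: rs (nu f).-1 si ti => [|s' t' {}ss {}ts st _ IH] [|i] //=; last exact: IH.
by move=> [<-] [<-].
Qed.

Lemma fv_lams (xs : seq (var A)) s :
  fv (lams xs s) =i [pred y | (y \in fv s) && (y \notin xs)].
Proof.
elim: xs => [|x xs IH] y; first by rewrite !inE andbT.
by rewrite mem_fv_close inE /= IH !inE negb_or; case: (y \in fv s); rewrite //= andbC.
Qed.

Lemma closed_lams (xs : seq (var A)) s : xs =i fv s -> closed (lams xs s).
Proof.
move=> xs_s; case E : (fv (lams xs s)) (fv_lams xs s) => [|y ys] //.
by move/(_ y); rewrite !inE eqxx xs_s andbN.
Qed.

Lemma subterm_lams (xs : seq (var A)) s : subterm (lams xs s) s.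
Proof.
elim: xs => [|x xs IH]; first exact: subterm_refl.
exact: subterm_lam.
Qed.

Lemma same_strips_lams gamma delta (xs : seq (var A)) s :
  same_strips gamma delta s -> same_strips gamma delta (lams xs s).
Proof. by move=> same; elim: xs => //= x xs IH; apply/same_strips_lam. Qed.

Lemma closed_subterm_arg (nu : symbol A -> nat) s u :
  closed s -> projects nu s u -> closed u.
Proof.
move=> cl_s /projects_fv; rewrite cl_s /closed.
by case: (fv u) => // x xs /(_ x); rewrite inE eqxx => /(_ isT).
Qed.

(** A well-defined projection forces [p] to be a symbol with at least one argument, which rules out
    the collapsing form of the target. *)
Lemma dp_target_subst (nu : symbol A -> nat) p gamma t v :
  projects nu p v -> dp_target p gamma t -> t = subst gamma p.
Proof.
move=> [f [ss [-> nuf _]]]; case: (lastP ss) nuf => [|ts u _]; first by case: (nu f).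
by rewrite apps_rcons.
Qed.

(** * Descent of projections under the subterm criterion *)

Section Criterion.

Variables (P P1 P2 : dp A -> Prop) (nu : symbol A -> nat) (R : rule A -> Prop).
Hypothesis crit : subterm_criterion P P1 P2 nu.

Lemma criterion_subterm rho u v :
  P rho -> projects nu (dlhs rho) u -> projects nu (drhs rho) v -> subterm u v.
Proof.
case: crit => [[PE _] _ _ P1P P2P].
move=> /PE[/P1P[u' [v' [lu' rv' [uv _]]]]|/P2P[u' [lu' ru']]] lu rv.
  by rewrite (projects_inj lu lu') (projects_inj rv rv').
by rewrite (projects_inj lu lu') (projects_inj rv ru'); apply: subterm_refl.
Qed.

(** The variables of a right-hand side are sent to distinct fresh names, which can therefore name
    the binders on the path from [u] to [v]. *)
Lemma dp_subst_subterm rho gamma u v :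
  dp_subst rho gamma -> projects nu (drhs rho) v -> closed u -> subterm u v ->
  subterm (subst gamma u) (subst gamma v) /\
  (u <> v -> msize (subst gamma v) < msize (subst gamma u)).
Proof.
move=> [wf_g _ _ fresh inj] /projects_fv sub cl_u uv.
apply: subterm_subst => // [x /sub|x y /sub xp /sub yp]; last exact: inj.
exact: fresh.
Qed.

(** The relation between the projections is stable under the substitution of the step; strictness
    survives because the size still decreases. *)
Lemma dp_step_projects rho s t :
  P rho -> dp_step rho s t ->
  exists a b, [/\ projects nu s a, projects nu t b &
    P1 rho /\ strict_subterm a b \/ P2 rho /\ a = b].
Proof.
case: crit => [[PE _] _ _ P1P P2P] Prho [gamma [ds _ -> tgt]].
have /PE[P1rho|P2rho] := Prho; last first.
  have [u [lu ru]] := P2P _ P2rho; rewrite (dp_target_subst ru tgt).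
  by exists (subst gamma u), (subst gamma u); split; [exact: projects_subst..|right].
have [u [v [lu rv uv]]] := P1P _ P1rho; rewrite (dp_target_subst rv tgt).
exists (subst gamma u), (subst gamma v); split; [exact: projects_subst..|left; split=> //].
have cl_u := closed_subterm_arg (dp_closed rho) lu.
case: uv => uv neq; have [uvg lt] := dp_subst_subterm ds rv cl_u uv.
exact: strict_subtermP uvg (lt neq).
Qed.

(* The substitution witnessing computability need not be the one witnessing the
   chain step, but both match the left-hand side, so they agree on the
   meta-variables of [v]. *)
Lemma computable_projection U C rho gamma s b :
  is_CU U C -> (forall s t, step R s t -> step U s t) ->
  P rho -> dp_step rho s (subst gamma (drhs rho)) ->
  wf_msubst gamma -> s = subst gamma (dlhs rho) ->
  (forall B v xs, brsm B (drhs rho) v -> respects gamma B ->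
     uniq xs -> xs =i fv v -> computable C (subst gamma (lams xs v))) ->
  projects nu (subst gamma (drhs rho)) b -> terminating R b.
Proof.
move=> CU RU Prho [delta [ds _ -> tgt]] wf_g eq_l comp tb.
have [_ _ /(_ _ Prho)[[u lu] [v rv]] _ _] := crit.
have [wf_d dom_d _ fresh inj] := ds.
rewrite (dp_target_subst rv tgt) in tb.
rewrite (projects_inj tb (projects_subst delta rv)).
have same_l : same_strips gamma delta (dlhs rho).
  apply: pattern_same_strips (esym eq_l) => //; first exact: dp_pattern.
    by move=> Z Zl; apply/dom_d; rewrite mem_cat Zl.
  by split=> x; rewrite (dp_closed rho).
have same_v : same_strips gamma delta v.
  apply: same_strips_subterm (criterion_subterm Prho lu rv) _.
  by apply: same_strips_subterm same_l; have [] := projects_strict_subterm lu.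
pose xs := undup (fv v); have xsE : xs =i fv v by apply: mem_undup.
have cl_v := closed_lams xsE.
(* [gamma] and [delta] may differ on the free variables of [v]; once these are abstracted, agreement
   on the meta-variables is enough. *)
have : terminating R (subst delta (lams xs v)).
  rewrite -(@same_strips_subst gamma); last first.
  - by move=> x; rewrite cl_v.
  - exact: same_strips_lams.
  apply: sn_sub (computable_terminating CU _); first by move=> *; apply: RU.
  (* As [v] is a direct argument of the right-hand side, it is reached with the empty set of
     conditions, which every substitution respects. *)
  apply: (comp (fun _ _ => False)) => //; last exact: undup_uniq.
  have [f [ss [-> _ vi]]] := rv.
  by apply: brsm_arg vi (brsm_head _ v [::]); rewrite orbT.
(* The fresh names given by [delta] make the instance of [v] a subterm of the instance of its
   abstraction. *)
move/terminating_subterm; apply.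
by have [] := dp_subst_subterm ds rv cl_v (subterm_lams xs v).
Qed.

Definition weak_descent := clos_refl_trans _ (step_or_subterm R).
Definition strict_descent := clos_trans _ (step_or_subterm R).

Lemma strict_descent_trans s t u :
  weak_descent s t -> strict_descent t u -> strict_descent s u.
Proof.
move=> st; elim: st u => [{}s {}t st u|//|{}s v {}t _ IH1 _ IH2 u /IH2/IH1//].
exact: t_trans (t_step _ _ _ _ st).
Qed.

(** A target with a projection is headed by a symbol, hence so is the next source, which excludes
    [beta]. The descent is the reduction along the link followed by the subterm step of the DP. *)
Lemma chain_projects_next c i b :
  chain P R c -> projects nu (ctgt c i) b ->
  exists rho b', [/\ crho c i.+1 = Some rho, P rho, projects nu (ctgt c i.+1) b',
    weak_descent b b' & P1 rho -> strict_descent b b'].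
Proof.
move=> chn tb; have [_ _ _ lk] := chn i; have [_ _] := chn i.+1.
case E : (crho c i.+1) => [rho|]; last first.
  have [f [ss [ti _ _]]] := tb.
  have [g [ts si]] : exists g ts, csrc c i.+1 = apps (Fun g) ts.
    case: lk => [<-|[g [us [ts [_ -> _]]]]]; first by exists f, ss.
    by exists g, ts.
  case=> x [u [v [ws [Es _]]]]; have := congr1 (@spine_head A) Es.
  by rewrite si !spine_head_apps.
move=> [Prho ds] _; have [a [b' [sa tb' ab']]] := dp_step_projects Prho ds.
exists rho, b'.
have ba : weak_descent b a.
  elim: (linked_projects lk tb sa) => [x y xy|x|x y z _ xy _ yz].
  - by apply: rt_step; left.
  - exact: rt_refl.
  - exact: rt_trans xy yz.
split=> //; case: ab' => [[_ ab']|[P2rho <-]] //.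
- by apply: rt_trans ba (rt_step _ _ _ _ _); right.
- by move=> _; apply: strict_descent_trans ba (t_step _ _ _ _ _); right.
- by move=> P1rho; case: crit => [[_ disj] _ _ _ _]; case: (disj rho).
Qed.

(** Well-founded induction on the projected term: the next use of [P1] produces a strict descendant,
    from which the argument restarts. *)
Lemma chain_P1_not_frequent c i b :
  chain P R c -> projects nu (ctgt c i) b -> terminating R b ->
  ~ (forall N, exists j rho, [/\ N <= j, crho c j = Some rho & P1 rho]).
Proof.
move=> chn tb sn_b freq.
have : Acc (fun u t => strict_descent t u) b.
  (* This closes the inverse relation transitively, so the order of the steps must be reversed to
     match [strict_descent]. *)
  have := Acc_clos_trans _ _ _ (sn_step_or_subterm sn_b).
  elim=> {b tb sn_b} b _ IH; constructor=> u bu; apply: IH.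
  elim: bu => [s t st|s t v _ st _ tv]; first exact: t_step.
  exact: t_trans tv st.
move=> acc_b; elim: acc_b i tb => {sn_b}b _ IH i tb.
(* The use at [j] lies strictly after [i], so walking [j - i.+1] entries leads to the target just
   before it. *)
have [j [rho [ij jrho P1rho]]] := freq i.+1.
have walk n : exists2 b', projects nu (ctgt c (i + n)) b' & weak_descent b b'.
  elim: n => [|n [b' tb' bb']]; first by exists b; rewrite ?addn0 //; apply: rt_refl.
  have [_ [b'' [_ _ tb'' b'b'' _]]] := chain_projects_next chn tb'.
  by exists b''; rewrite ?addnS //; apply: rt_trans bb' b'b''.
have [b' tb' bb'] := walk (j - i.+1).
have [rho' [b'' [rho'E _ tb'' _ b'b'']]] := chain_projects_next chn tb'.
have Ej : (i + (j - i.+1)).+1 = j by lia.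
move: rho'E; rewrite Ej jrho => -[E]; subst rho'.
exact: IH (strict_descent_trans bb' (b'b'' P1rho)) _ tb''.
Qed.

End Criterion.

(** * Tails of chains and change of the set of DPs *)

Definition shift N (c : chain_data A) : chain_data A :=
  ChainData (fun i => crho c (N + i)) (fun i => csrc c (N + i)) (fun i => ctgt c (N + i)).

Lemma chain_shift (P Q : dp A -> Prop) R N c :
  chain P R c ->
  (forall i rho, N <= i -> crho c i = Some rho -> P rho -> Q rho) ->
  chain Q R (shift N c).
Proof.
move=> chn PQ i; have [ts tt] := chn (N + i).
rewrite /= addnS; case E : (crho c (N + i)) => [rho|] st lk; split=> //.
by have [Prho ds] := st; split=> //; apply: PQ E Prho; rewrite leq_addr.
Qed.

Lemma chain_sub (P Q : dp A -> Prop) R c :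
  (forall rho, P rho -> Q rho) -> chain P R c -> chain Q R c.
Proof.
move=> PQ chn i; have [ts tt] := chn i; case: (crho c i) => [rho|] st lk; split=> //.
by have [/PQ] := st.
Qed.

End Terms.

(** * Soundness and completeness of the subterm criterion processor *)

Theorem theorem4p29 (A : signature) (Proc : dp_problem A -> proc_result A) :
  subterm_processor Proc -> sound Proc /\ complete Proc.
Proof.
move=> procP; split=> [M Q|M]; last first.
  (* Completeness: rules and flags are kept, so chains of the resulting problem are chains of [M],
     and non-termination is shared. *)
  case: (procP M) => [[P2 [_ [P1 [nu [[PE _] _ _ _ _]]]] ->]|[_ ->]] [M' -> //].
  case=> [not_fin|nonterm]; [left=> fin|by right]; apply: not_fin => -[c [chn]].
  move=> m f; apply: fin; exists c; split=> //.
  by apply: chain_sub chn => rho P2rho; apply/PE; right.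
case: (procP M) => [[P2 [mM [P1 [nu crit]]] ->]|[_ ->]] [<-] /(_ _ erefl) // fin.
case=> c [chn mc fc].
(* Either some tail uses only [P2] among the DPs and contradicts finiteness of the resulting
   problem, or [P1] is used infinitely often. *)
have [tail|not_tail] := classic (exists N, forall i rho,
    N <= i -> crho c i = Some rho -> pairs M rho -> P2 rho).
  have [N NP2] := tail; apply: fin; exists (shift N c); split.
  - exact: chain_shift chn NP2.
  - move: mc; rewrite /=; case: (mflag M) => [mc|//|U [RU [C CU comp]]].
      by move=> i t; apply: mc.
    by split=> //; exists C => // i; apply: comp.
  - case: (fflag M) fc => //= fc i rho; rewrite /= addnS; exact: fc.
have freq N : exists j rho, [/\ N <= j, crho c j = Some rho & P1 rho].
  apply: NNPP => none; apply: not_tail; exists N => i rho Ni ci Prho.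
  have [[PE _] _ _ _ _] := crit; have /PE[P1rho|//] := Prho.
  by case: none; exists i, rho.
(* Any use of [P1] yields a target with a projection, from which the descent can start. *)
have [j [rho [_ cj P1rho]]] := freq 0.
have [_ _] := chn j; rewrite cj => -[Prho ds] _.
have [a [b [_ tb _]]] := dp_step_projects crit Prho ds.
apply: (chain_P1_not_frequent crit chn tb) freq.
case: mM mc => [->|[U ->]] /=.
  by apply; apply: projects_strict_subterm tb.
move=> [RU [C CU /(_ j)[rho' [gamma [cj' wf_g sE tE comp]]]]].
move: cj'; rewrite cj => -[E]; subst rho'; rewrite tE in tb ds.
exact: (computable_projection crit CU RU Prho ds wf_g sE comp tb).
Qed.
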